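(* Let $E,E'$ be real Banach spaces of dimension at least $2$, and let $G\subsetneq E$ and $G'\subsetneq E'$ be domains. Suppose that $f:G\to G'$ is $(M,C)$-CQH, and that $f$ extends to a homeomorphism $f:\overline{G}\to\overline{G'}$ which is $\eta$-quasimöbius relative to $\partial G$. (1) If $G$ is $\psi$-natural, then $G'$ is $\psi'$-natural with $\psi'=\psi'(\psi,M,C,\eta)$ depending only on $\psi,M,C,\eta$. (2) If $G$ is $c$-uniform, then $G'$ is $c'$-uniform with $c'=c'(c,M,C,\eta)$ depending only on $c,M,C,\eta$.
   Context: A domain is a nonempty connected open set; norms are written $|\cdot|$. For a set $A$ in a Banach space, $\overline{A}$ denotes its completion (that is, its norm closure) and $\partial A=\overline{A}\setminus A$ its norm boundary. For $x\in G$, $d_G(x)=\operatorname{dist}(x,\partial G)$. For an arc $\gamma$ and $x,z\in\gamma$, $\gamma[x,z]$ is the subarc between $x$ and $z$, and $\ell(\gamma)$ is the norm length. Relative quasimöbius maps: for a metric space $X$ write $\dot X=X\cup\{\infty\}$. The cross ratio of four distinct points is $\tau(x,y,z,w)=\frac{|x-z|}{|x-y|}\cdot\frac{|y-w|}{|z-w|}$, where $|a-b|$ denotes distance; if one of the points is $\infty$, the two distances involving it are cancelled, e.g. $\tau(x,y,z,\infty)=\frac{|x-z|}{|x-y|}$. Let $\eta:[0,\infty)\to[0,\infty)$ be a homeomorphism, $X,Y$ metric spaces, and $A\subseteq X_0\subseteq\dot X$. An embedding $f:X_0\to\dot Y$ is $\eta$-quasimöbius relative to $A$ if $\tau(f(x),f(y),f(z),f(w))\le\eta(\tau(x,y,z,w))$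 for every quadruple of distinct points $x,y,z,w\in X_0$ with $\{x,w\}\subseteq A$ or $\{y,z\}\subseteq A$. In the claim this is applied with $X_0=\overline G$ and $A=\partial G$. Quasihyperbolic metric: $k_G(x,y)=\inf\int_\alpha\frac{|dz|}{d_G(z)}$, the infimum over all rectifiable curves $\alpha$ in $G$ joining $x$ and $y$. Put $r_G(x,y)=\frac{|x-y|}{\min\{d_G(x),d_G(y)\}}$ and, for nonempty $A\subseteq G$, $r_G(A)=\sup_{x,y\in A}r_G(x,y)$, $k_G(A)=\sup_{x,y\in A}k_G(x,y)$. $(M,C)$-CQH ($M\ge1$, $C\ge0$): a homeomorphism $f:G\to G'$ with $\frac{k_G(x,y)-C}{M}\le k_{G'}(f(x),f(y))\le Mk_G(x,y)+C$ for all $x,y\in G$. $\psi$-natural: for an increasing function $\psi:[0,\infty)\to[0,\infty)$, $G$ is $\psi$-natural if $k_G(A)\le\psi(r_G(A))$ for every nonempty connected $A\subseteq G$ with $r_G(A)<\infty$. $c$-uniform ($c\ge1$): each pair of points $x,y\in G$ can be connected by an arc $\gamma$ in $G$ with $\ell(\gamma)\le c|x-y|$ and $\min\{\ell(\gamma[x,z]),\ell(\gamma[z,y])\}\le c\,d_G(z)$ for all $z\in\gamma$. (The same definitions are used for $G'$ in $E'$.) *)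

(* Defs.v *)
From HB Require Import structures.
From mathcomp Require Import all_boot all_order all_algebra.
From mathcomp Require Import all_classical all_reals all_analysis.

Set Implicit Arguments.
Unset Strict Implicit.
Unset Printing Implicit Defensive.

Import Order.TTheory GRing.Theory Num.Theory.
Import numFieldNormedType.Exports.

Local Open Scope classical_set_scope.
Local Open Scope ring_scope.

Definition homeomorphism_on (T U : topologicalType) (A : set T) (B : set U)
    (f : T -> U) : Prop :=
  exists g : U -> T,
    [/\ set_fun A B f /\ set_fun B A g,
        {in A, cancel f g},
        {in B, cancel g f},
        {within A, continuous f} &
        {within B, continuous g}].

(* Functions [0, oo) -> [0, oo) are total functions R -> R, of which only the
   values on `[0, +oo[ matter. *)
Definition homeo_gauge (R : realType) (eta : R -> R) : Prop :=
  @homeomorphism_on R R [set` `[0, +oo[] [set` `[0, +oo[] eta.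

Definition increasing_gauge (R : realType) (psi : R -> R) : Prop :=
  {in `[0, +oo[, forall t, 0 <= psi t} /\
  {in `[0, +oo[ &, {homo psi : s t / s <= t}}.

Section NormedSpace.
Context {R : realType} {E : normedModType R}.
Implicit Types (G A : set E) (x y z : E) (g : R -> E) (a b t s : R).

Definition dim_ge2 (V : normedModType R) : Prop :=
  exists u v : V, forall p q : R, p *: u + q *: v = 0 -> p = 0 /\ q = 0.

Definition is_domain G : Prop := [/\ G !=set0, open G & connected G].

Definition boundary A : set E := closure A `\` A.

(* Real infimum: for a nonempty proper open G, the boundary is nonempty. *)
Definition bdist G x : R := inf [set `|x - y| | y in boundary G].

(* A partition of [a, b] is the list of its points except a, as for the
   library's [variation] and [total_variation], which are for real-valued
   functions only. *)
Definition curve_variation g a b (s : seq R) : R :=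
  let F := g \o nth b (a :: s) in
  \sum_(0 <= n < size s) `|F n.+1 - F n|.

Definition curve_length g a b : \bar R :=
  ereal_sup [set (curve_variation g a b s)%:E | s in itv_partition a b].

(* The arc length parametrization s |-> g(t) of g on [a, b]: t is the first
   parameter at which the length travelled along g reaches s. *)
Definition arclength_param g a b s : E :=
  g (inf [set t | t \in `[a, b] /\ (s%:E <= curve_length g a t)%E]).

(* The integral of rho |dz| along a rectifiable curve g on [a, b]. *)
Definition line_integral (rho : E -> R) g a b : \bar R :=
  (\int[lebesgue_measure]_(s in [set` `[0%R, fine (curve_length g a b)]])
     (rho (arclength_param g a b s))%:E)%E.

Definition curve_in G g a b : Prop :=
  [/\ a <= b, {within [set` `[a, b]], continuous g} &
      forall t, t \in `[a, b] -> G (g t)].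

Definition rectifiable g a b : Prop := (curve_length g a b < +oo)%E.

(* a = b is allowed: a point is a degenerate arc, joining x to itself. *)
Definition arc_in G g a b : Prop :=
  curve_in G g a b /\ {in `[a, b] &, injective g}.

Definition qhyp G x y : \bar R :=
  ereal_inf [set I | exists g a b,
    [/\ curve_in G g a b, rectifiable g a b, g a = x, g b = y &
        I = line_integral (fun z => (bdist G z)^-1) g a b]].

Definition rel_dist G x y : R := `|x - y| / Num.min (bdist G x) (bdist G y).

Definition rel_diam G A : \bar R :=
  ereal_sup [set r | exists x y, [/\ A x, A y & r = (rel_dist G x y)%:E]].

Definition qhyp_diam G A : \bar R :=
  ereal_sup [set k | exists x y, [/\ A x, A y & k = qhyp G x y]].

Definition natural_domain (psi : R -> R) G : Prop :=
  forall A, A !=set0 -> A `<=` G -> connected A ->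
    (rel_diam G A < +oo)%E ->
    (qhyp_diam G A <= (psi (fine (rel_diam G A)))%:E)%E.

(* For z = g t, the subarcs from g a to z and from z to g b are the
   restrictions of g to [a, t] and to [t, b]. *)
Definition uniform_domain (c : R) G : Prop :=
  forall x y, G x -> G y ->
    exists g a b,
      [/\ arc_in G g a b, g a = x, g b = y,
          (curve_length g a b <= (c * `|x - y|)%:E)%E &
          forall t, t \in `[a, b] ->
            (Order.min (curve_length g a t) (curve_length g t b)
               <= (c * bdist G (g t))%:E)%E].

Definition cross_ratio x y z w : R :=
  (`|x - z| / `|x - y|) * (`|y - w| / `|z - w|).

End NormedSpace.

Section Maps.
Context {R : realType} {E E' : normedModType R}.
Implicit Types (A G : set E) (f : E -> E').

Definition coarsely_qh (M C : R) G (G' : set E') f : Prop :=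
  homeomorphism_on G G' f /\
  forall x y, G x -> G y ->
    ((qhyp G x y - C%:E) / M%:E <= qhyp G' (f x) (f y))%E /\
    (qhyp G' (f x) (f y) <= M%:E * qhyp G x y + C%:E)%E.

(* Only finite points occur here: X0 and f @` X0 do not contain the point at
   infinity. *)
Definition quasimobius_rel (eta : R -> R) (X0 : set E) A f : Prop :=
  [/\ A `<=` X0,
      homeomorphism_on X0 (f @` X0) f &
      forall x y z w, X0 x -> X0 y -> X0 z -> X0 w ->
        uniq [:: x; y; z; w] ->
        (A x /\ A w) \/ (A y /\ A z) ->
        cross_ratio (f x) (f y) (f z) (f w) <= eta (cross_ratio x y z w)].

End Maps.

(* Main.v *)
(* Write x' for f(x), d for the distance to the boundary, k and r for the
   quasihyperbolic and relative distances.  The heart of the matter is that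
   r(x', y') bounds r(x, y).  If r(x, y) were huge with d(y) <= d(x), comparing
   cross ratios of x, y and two boundary points would confine the boundary of G
   to a ball around y that is small compared with |x - y|.  A sphere S around y
   slightly larger than this ball has bounded k-diameter, because the dimension
   is at least 2, while k(x, S) is huge; and f(S) separates x' from y' in E'.
   Along the segment from x' to f(S), d cannot stay comparable to d(x'), since
   k(x', f(S)) is huge.  So the segment runs very close to the boundary of G',
   hence f(S) has a point very close to that boundary, and having bounded
   k-diameter it lies in a tiny ball away from x' and y'.  The complement of a
   ball is connected, so f(S) cannot separate x' from y'.

   Part (1) follows at once.  For part (2), let z run through a uniform arc from
   x to y.  Then |z' - x'| or |z' - y'| is at most a constant times d(z').
   Otherwise the cross ratios confine the boundary of G' to a ball around z' of
   radius comparable to d(z'); the image arc crosses a larger sphere around z'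
   both before and after z', at two points whose relative distance is bounded,
   so that k between them and z is bounded, a contradiction.  Hence |z' - x'| is
   at most a constant times d(z') until the image arc leaves the ball of radius
   |x' - y'| / 2 around x'.  Going back along this part to points where d has
   been halved, and joining successive points by chains of length comparable to
   d, gives geometric series of lengths.  The same is done from y', the two ends
   are joined, and the resulting polygonal chain is pruned to an arc. *)

Require Import Defs.
From mathcomp Require Import all_boot all_order all_algebra.
From mathcomp Require Import all_classical all_reals all_analysis.
From mathcomp Require Import ring lra.
Import Order.TTheory GRing.Theory Num.Theory.
Import numFieldNormedType.Exports.
Local Open Scope classical_set_scope.
Local Open Scope ring_scope.

Set Implicit Arguments.
Unset Strict Implicit.

(** * Distance to the boundary *)

Lemma within_continuousP (R : realType) (V W : pseudoMetricNormedZmodType R)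
    (A : set V) (f : V -> W) :
  {within A, continuous f} <->
  forall x, A x -> forall e, 0 < e -> exists2 r, 0 < r &
    forall y, A y -> `|x - y| < r -> `|f x - f y| < e.
Proof.
split.
  move=> /subspace_continuousP cf x Ax e e0.
  have /cvgrPdist_lt /(_ e e0) := cf x Ax.
  rewrite near_withinE => /nbhs_normP[r /= r0 H].
  by exists r => // y Ay xy; apply: H.
move=> H; apply/subspace_continuousP => x Ax.
apply/cvgrPdist_lt => e e0.
have [r r0 Hr] := H x Ax e e0.
rewrite near_withinE; apply/nbhs_normP; exists r => //= y /= xy Ay.
exact: Hr.
Qed.

Lemma open_normP (R : realType) (V : pseudoMetricNormedZmodType R) (A : set V) :
  open A <-> forall x, A x -> exists2 r, 0 < r & forall y, `|x - y| < r -> A y.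
Proof.
rewrite openE; split.
  move=> H x /H /nbhs_normP[r /= r0 Hr]; exists r => // y xy; exact: Hr.
move=> H x /H [r r0 Hr]; apply/nbhs_normP; exists r => //= y; exact: Hr.
Qed.

Lemma closure_normP (R : realType) (V : pseudoMetricNormedZmodType R) (A : set V) x :
  closure A x <-> forall r, 0 < r -> exists2 y, A y & `|x - y| < r.
Proof.
split.
  move=> H r r0.
  have /H [y [Ay /= xy]] : nbhs x [set y | `|x - y| < r].
    by apply/nbhs_normP; exists r => //=.
  by exists y.
move=> H B /nbhs_normP[r /= r0 Hr].
by have [y Ay xy] := H r r0; exists y; split => //; apply: Hr.
Qed.

Lemma lipschitz_within (R : realType) (V W : pseudoMetricNormedZmodType R)
    (A : set V) (f : V -> W) (k : R) :
  (forall x y, A x -> A y -> `|f x - f y| <= k * `|x - y|) ->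
  {within A, continuous f}.
Proof.
move=> H; apply/within_continuousP => x Ax e e0.
have k0 : 0 < `|k| + 1 by rewrite ltr_wpDl.
exists (e / (`|k| + 1)); first exact: divr_gt0.
move=> y Ay; rewrite ltr_pdivlMr // => xy.
apply: le_lt_trans (H _ _ Ax Ay) _; apply: le_lt_trans xy.
by rewrite mulrC ler_wpM2l // (le_trans (ler_norm k)) // lerDl.
Qed.

Section Segments.
Context {R : realType} {E : normedModType R}.
Implicit Types (G A B : set E) (x y z : E) (t : R).

Definition segpt x y t : E := x + t *: (y - x).
Definition seg x y : set E := segpt x y @` `[0, 1].

Lemma segpt0 x y : segpt x y 0 = x.
Proof. by rewrite /segpt scale0r addr0. Qed.

Lemma segpt1 x y : segpt x y 1 = y.
Proof. by rewrite /segpt scale1r addrC subrK. Qed.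

Lemma segpt_dist x y s t : `|segpt x y s - segpt x y t| = `|s - t| * `|x - y|.
Proof.
rewrite /segpt opprD addrACA subrr add0r -scalerBl normrZ.
by rewrite (distrC x y).
Qed.

Lemma seg_l x y : seg x y x.
Proof. by exists 0; rewrite ?segpt0 //= in_itv /= lexx ler01. Qed.

Lemma seg_r x y : seg x y y.
Proof. by exists 1; rewrite ?segpt1 //= in_itv /= lexx ler01. Qed.

Lemma seg_dist x y z : seg x y z -> `|x - z| <= `|x - y| /\ `|z - y| <= `|x - y|.
Proof.
move=> [t /=]; rewrite in_itv /= => /andP[t0 t1] <-.
have -> : `|x - segpt x y t| = t * `|x - y|.
  by rewrite -{1}(segpt0 x y) segpt_dist sub0r normrN ger0_norm.
have -> : `|segpt x y t - y| = (1 - t) * `|x - y|.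
  by rewrite -{2}(segpt1 x y) segpt_dist distrC ger0_norm // subr_ge0.
by split; rewrite ler_piMl //; lra.
Qed.

Lemma segpt_continuous x y (A : set R) : {within A, continuous (segpt x y)}.
Proof.
apply: (@lipschitz_within _ R E _ _ `|x - y|) => s t _ _.
by rewrite segpt_dist mulrC.
Qed.

Lemma connected_seg x y : connected (seg x y).
Proof.
apply: connected_continuous_connected; first exact: segment_connected.
exact: segpt_continuous.
Qed.

(** Since [B] misses the boundary, it meets [G] and the closure of [G] in the same set, which is
    therefore open and closed in [B]. *)
Lemma connected_sub_open G B : open G -> connected B -> B `&` G !=set0 ->
  (forall p, B p -> ~ boundary G p) -> B `<=` G.
Proof.
move=> oG cB BG0 Bb.
suff <- : B `&` G = B by move=> x [].
apply: cB => //; first by exists G.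
exists (closure G); first exact: closed_closure.
rewrite predeqE => x; split=> -[Bx Gx]; split => //; first exact: subset_closure.
by apply: contrapT => nG; apply: (Bb x Bx); split.
Qed.

Section Domain.
Variable G : set E.
Hypotheses (dG : is_domain G) (pG : G != [set: E]).

(** A segment from a point of [G] to a point outside it has to cross the boundary. This makes the
    real infimum in [bdist] a true distance. *)
Lemma boundary_nonempty : boundary G !=set0.
Proof.
have [[x Gx] oG _] := dG.
have [y nGy] : exists y, ~ G y.
  apply: contrapT => H; move/negP: pG; apply; apply/eqP.
  rewrite predeqE => y; split => // _; apply: contrapT => nG; apply: H; by exists y.
apply: contrapT => H; apply: nGy.
apply: (@connected_sub_open G (seg x y)) => //.
- exact: connected_seg.
- by exists x; split => //; exact: seg_l.
- by move=> p _ bp; apply: H; exists p.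
- exact: seg_r.
Qed.

Lemma bdist_le x p : boundary G p -> bdist G x <= `|x - p|.
Proof.
move=> bp; apply: ge_inf; last by exists p.
by exists 0 => _ [z _ <-]; exact: normr_ge0.
Qed.

Lemma le_bdist x r : (forall p, boundary G p -> r <= `|x - p|) -> r <= bdist G x.
Proof.
move=> H; apply: lb_le_inf.
  by have [p bp] := boundary_nonempty; exists `|x - p|; exists p.
by move=> _ [p bp <-]; exact: H.
Qed.

Lemma bdist_lt_ex x r : bdist G x < r -> exists2 p, boundary G p & `|x - p| < r.
Proof.
move=> xr; apply: contrapT => H; move: xr; rewrite ltNge => /negP; apply.
apply: le_bdist => p bp; rewrite leNgt; apply/negP => h; apply: H; by exists p.
Qed.

Lemma bdist_lip x y : bdist G x <= bdist G y + `|x - y|.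
Proof.
rewrite -lerBlDr; apply: le_bdist => p bp; rewrite lerBlDr.
apply: le_trans (bdist_le x bp) _; rewrite [leRHS]addrC; exact: ler_distD.
Qed.

Lemma bdist_dist x y : `|bdist G x - bdist G y| <= `|x - y|.
Proof.
rewrite ler_norml; have := bdist_lip x y; have := bdist_lip y x.
rewrite (distrC y x); lra.
Qed.

Lemma bdist_gt0 x : G x -> 0 < bdist G x.
Proof.
have [_ oG _] := dG => Gx; have [r r0 Hr] := (iffLR (open_normP G) oG) x Gx.
apply: lt_le_trans r0 _; apply: le_bdist => p [_ nGp].
rewrite leNgt; apply/negP => /Hr; exact: nGp.
Qed.

Lemma bdist_near x : G x -> exists2 p, boundary G p & `|x - p| <= 2 * bdist G x.
Proof.
move=> Gx; have d0 := bdist_gt0 Gx.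
have [|p bp xp] := @bdist_lt_ex x (2 * bdist G x); first lra.
by exists p => //; exact: ltW.
Qed.

Lemma bdist_ball x y : G x -> `|x - y| < bdist G x -> G y.
Proof.
move=> Gx xy; apply: (@connected_sub_open G (seg x y)).
- by case: dG.
- exact: connected_seg.
- by exists x; split => //; exact: seg_l.
- move=> p /seg_dist[xp _] /(bdist_le x); apply/negP; rewrite -ltNge.
  exact: le_lt_trans xy.
- exact: seg_r.
Qed.

End Domain.
End Segments.

(** * Paths around a ball *)

Section Planar.
Context {R : realType} {E : normedModType R}.
Implicit Types (a b e o x y : E) (r : R).

Lemma dim_ge2_notin_line a : dim_ge2 E -> exists w : E, forall p : R, w != p *: a.
Proof.
move=> [u [v uv]]; apply: contrapT => H.
have /existsNP[p /negP/negPn/eqP up] : ~ forall p : R, u != p *: a.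
  by move=> h; apply: H; exists u.
have /existsNP[q /negP/negPn/eqP vq] : ~ forall p : R, v != p *: a.
  by move=> h; apply: H; exists v.
have [|q0 p0] := uv q (- p).
  by rewrite up vq !scalerA -scalerDl mulNr mulrC subrr scale0r.
have [|] := uv 1 0; last by move=> /eqP; rewrite oner_eq0.
by rewrite scale0r addr0 scale1r up (_ : p = 0) ?scale0r //; lra.
Qed.

(** For a vector [w] off the line spanned by [a], the vector [e] leads from a nearest point of that
    line to [w]. *)
Lemma birkhoff_orthogonal a : dim_ge2 E -> a != 0 ->
  exists2 e : E, e != 0 & forall p : R, `|e| <= `|e + p *: a|.
Proof.
move=> /(dim_ge2_notin_line a)[w wa] a0.
have na0 : 0 < `|a| by rewrite normr_gt0.
(* If |p| > B, then |p a| > 2 |w| and so |w + p a| > |w|; hence a minimum over [-B, B] is global. *)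
pose B := 2 * `|w| / `|a|.
have B0 : 0 <= B by rewrite divr_ge0 // mulr_ge0.
have [||p0 _ Hp0] := @EVT_min R (fun p => `|w + p *: a|) (- B) B; first lra.
  apply: (@lipschitz_within _ _ _ _ _ `|a|) => p q _ _.
  apply: le_trans (ler_dist_dist _ _) _.
  by rewrite opprD addrACA subrr add0r -scalerBl normrZ mulrC.
exists (w + p0 *: a).
  by apply/negP; rewrite addr_eq0 -scaleNr => /eqP h; move: (wa (- p0)); rewrite h eqxx.
move=> p; rewrite -addrA -scalerDl; set q := p0 + p.
have [qB|qB] := boolP (q \in `[- B, B]); first exact: Hp0.
have : `|w + p0 *: a| <= `|w|.
  by have := Hp0 0; rewrite scale0r addr0; apply; rewrite in_itv /=; lra.
move/le_trans; apply.
have : B < `|q|.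
  rewrite ltNge; apply: contra qB; rewrite ler_norml in_itv /=; lra.
rewrite /B ltr_pdivrMr // -normrZ => h.
have := lerB_normD (q *: a) w; rewrite addrC; lra.
Qed.

Lemma birkhoff_orthogonal_scaled a : dim_ge2 E -> a != 0 ->
  exists2 e : E, `|e| = `|a| & forall s p : R, `|s| * `|a| <= `|s *: e + p *: a|.
Proof.
move=> d2 a0; have [e e0 He] := birkhoff_orthogonal d2 a0.
have ne0 : 0 < `|e| by rewrite normr_gt0.
exists ((`|a| / `|e|) *: e).
  by rewrite normrZ normrM normfV !normr_id mulfVK ?normr_eq0.
move=> s p; rewrite scalerA.
have [->|s0] := eqVneq s 0; first by rewrite normr0 mul0r.
have na0 : 0 < `|a| by rewrite normr_gt0.
set k := s * _.
have k0 : k != 0 by rewrite mulf_neq0 // gt_eqF // divr_gt0.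
have -> : k *: e + p *: a = k *: (e + (p / k) *: a).
  by rewrite scalerDr scalerA [k * _]mulrC mulfVK.
have -> : `|s| * `|a| = `|k| * `|e|.
  by rewrite /k !normrM normfV !normr_id -mulrA mulfVK ?normr_eq0.
by rewrite [leRHS]normrZ; apply: ler_wpM2l.
Qed.

Lemma segptE x y (t : R) : segpt x y t = (1 - t) *: x + t *: y.
Proof.
by rewrite /segpt scalerBr scalerBl scale1r addrA addrAC.
Qed.

(* If the segment [a, b] passes near 0 then b is close to -a, and a vector e
   that is Birkhoff orthogonal to a serves as an intermediate vertex. *)
Lemma two_segments_origin a b r : dim_ge2 E -> 0 < r -> `|a| = r -> `|b| = r ->
  exists2 e : E, `|e| = r & forall t : R, 0 <= t <= 1 ->
    r / 8 <= `|segpt a e t| /\ r / 8 <= `|segpt e b t|.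
Proof.
move=> d2 r0 ar br.
have [H|] := pselect (forall t : R, 0 <= t <= 1 -> r / 8 <= `|segpt a b t|).
  exists a => // t t01; split; last exact: H.
  by rewrite /segpt subrr scaler0 addr0 ar; lra.
move=> /existsNP[t0 /not_implyP[/andP[t00 t01] /negP]]; rewrite -ltNge => ht0.
have a0 : a != 0 by rewrite -normr_eq0 ar gt_eqF.
(* The two terms of the convex combination have norms (1 - t0) r and t0 r, which therefore differ by
   less than r/8. *)
have h1 : `|1 - 2 * t0| < 1 / 8.
  rewrite -(ltr_pM2r r0); apply: (@le_lt_trans _ _ `|segpt a b t0|); last by lra.
  rewrite segptE.
  have := lerB_normD ((1 - t0) *: a) (t0 *: b).
  have := lerB_normD (t0 *: b) ((1 - t0) *: a).
  rewrite [t0 *: b + _]addrC !normrZ ar br (ger0_norm t00).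
  rewrite (@ger0_norm _ (1 - t0)) ?subr_ge0 //.
  by case: (ger0P (1 - 2 * t0)); lra.
have abr : `|a + b| <= r / 2.
  have -> : a + b = 2 *: segpt a b t0 + (1 - 2 * t0) *: (b - a).
    rewrite /segpt scalerDr scalerA -addrA -scalerDl addrCA subrr addr0 scale1r.
    by rewrite scaler_nat mulr2n -addrA subrKC.
  apply: le_trans (ler_normD _ _) _; rewrite !normrZ.
  have := ler_normB b a; rewrite ar br => hba.
  have := ler_wpM2l (normr_ge0 (1 - 2 * t0)) hba.
  have : `|1 - 2 * t0| * (r + r) <= 1/8 * (r + r) 
    by rewrite ler_pM2r ?(ltW h1) // addr_gt0.
  rewrite (@ger0_norm _ 2) //; lra.
have [e er He] := birkhoff_orthogonal_scaled d2 a0.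
exists e; first by rewrite er.
(* On [a, e] the norm is at least t r, by orthogonality, and at least (1 - 2 t) r. On [e, b] it is
   at least (1 - 3 t / 2) r, by comparing b with -a, and at least (2 t - 1) r; the worst case is t =
   4/7 with the value r/7. *)
move=> t /andP[t_0 t_1]; rewrite !segptE; split.
  have := He t (1 - t); rewrite [t *: e + _]addrC ar ger0_norm // => h2.
  have := lerB_normD ((1 - t) *: a) (t *: e).
  rewrite !normrZ er ar !ger0_norm ?subr_ge0 // => h3; nra.
have := lerB_normD (t *: b) ((1 - t) *: e).
rewrite [t *: b + _]addrC !normrZ er ar br !ger0_norm ?subr_ge0 // => h3.
have := lerB_normD ((1 - t) *: e + (- t) *: a) (t *: (a + b)).
have -> : (1 - t) *: e + (- t) *: a + t *: (a + b) = (1 - t) *: e + t *: b.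
  by rewrite scalerDr scaleNr addrA addrNK.
have := He (1 - t) (- t); rewrite normrZ ar !ger0_norm ?subr_ge0 // => h4 h5.
have h6 := ler_wpM2l t_0 abr.
nra.
Qed.
End Planar.
Section PlanarConsequences.
Context {R : realType} {E : normedModType R}.
Implicit Types (a b e o x y z : E) (r : R).

Lemma segptB x y o (t : R) : segpt x y t - o = segpt (x - o) (y - o) t.
Proof. by rewrite /segpt addrAC opprB addrA addrNK. Qed.

Lemma two_segments a b o r : dim_ge2 E -> 0 < r -> `|a - o| = r -> `|b - o| = r ->
  exists2 e : E, `|e - o| = r & forall z, (seg a e `|` seg e b) z -> r / 8 <= `|z - o|.
Proof.
move=> d2 r0 ar br; have [e er He] := two_segments_origin d2 r0 ar br.
exists (e + o); first by rewrite addrK.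
by move=> z [] [t /=]; rewrite in_itv /= => /He[h1 h2] <-; rewrite segptB addrK.
Qed.

Lemma radial_segment a o r : 0 < `|a - o| -> `|a - o| <= r ->
  exists2 a1 : E, `|a1 - o| = r & forall z, seg a a1 z -> `|a - o| <= `|z - o|.
Proof.
move=> a0 ar; have r0 : 0 < r by exact: lt_le_trans ar.
exists (o + (r / `|a - o|) *: (a - o)).
  by rewrite addrAC subrr add0r normrZ ger0_norm ?divr_ge0 ?(ltW r0) // divfK // gt_eqF.
move=> z [t /=]; rewrite in_itv /= => /andP[t0 t1] <-.
rewrite segptB addrAC subrr add0r segptE scalerA -scalerDl normrZ.
rewrite ler_peMl // (le_trans _ (ler_norm _)) //.
have h : 1 <= r / `|a - o| by rewrite ler_pdivlMr // mul1r.
by have := ler_wpM2l t0 h; lra.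
Qed.

(** Both points are moved radially to a sphere so large that the two chords of [two_segments], which
    come closer to [o] by a factor of at most 8, still avoid the ball. *)
Lemma ball_complement_connected a b o r : dim_ge2 E -> 0 <= r ->
  r < `|a - o| -> r < `|b - o| ->
  exists B : set E, [/\ connected B, B a, B b & forall z, B z -> r < `|z - o|].
Proof.
move=> d2 r0 ra rb.
pose s := 8 * (`|a - o| + `|b - o|).
have [||a1 a1s Ha] := @radial_segment a o s; [lra|rewrite /s; lra|].
have [||b1 b1s Hb] := @radial_segment b o s; [lra|rewrite /s; lra|].
have [|e es He] := two_segments d2 _ a1s b1s; first by rewrite /s; lra.
exists (seg a a1 `|` (seg a1 e `|` (seg e b1 `|` seg b b1))); split.
- apply: connectedU; [|exact: connected_seg|].
    by exists a1; split; [exact: seg_r|left; exact: seg_l].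
  apply: connectedU; [|exact: connected_seg|].
    by exists e; split; [exact: seg_r|left; exact: seg_l].
  apply: connectedU; [|exact: connected_seg|exact: connected_seg].
  by exists b1; split; exact: seg_r.
- left; exact: seg_l.
- right; right; right; exact: seg_l.
- have s8 : r < s / 8 by rewrite /s; lra.
  move=> z [/Ha|[h|[h|/Hb]]]; try exact: lt_le_trans.
    by apply: lt_le_trans (He z _) => //; left.
  by apply: lt_le_trans (He z _) => //; right.
Qed.

End PlanarConsequences.
(** * Length of curves and quasihyperbolic distance *)

Section CurveLength.
Context {R : realType} {E : normedModType R}.
Implicit Types (g : R -> E) (a b c s t x : R) (l : seq R).

Lemma curve_variation_nil g a b : curve_variation g a b [::] = 0.
Proof. by rewrite /curve_variation big_geq. Qed.

Lemma curve_variation_cons g a b x l :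
  curve_variation g a b (x :: l) = `|g x - g a| + curve_variation g x b l.
Proof. by rewrite /curve_variation /= big_nat_recl. Qed.

(** The right end point enters only as the default value of [nth], so it may change when partitions
    are cut or joined. *)
Lemma curve_variation_default g a b c l :
  curve_variation g a b l = curve_variation g a c l.
Proof.
elim: l a => [|x l IH] a; first by rewrite !curve_variation_nil.
by rewrite !curve_variation_cons (IH x).
Qed.

Lemma curve_variation_cat g a b l l' :
  curve_variation g a b (l ++ l') =
  curve_variation g a b l + curve_variation g (last a l) b l'.
Proof.
elim: l a => [|x l IH] a; first by rewrite curve_variation_nil add0r.
by rewrite /= !curve_variation_cons IH addrA.
Qed.

Lemma curve_length_ub g a b l : itv_partition a b l ->
  ((curve_variation g a b l)%:E <= curve_length g a b)%E.
Proof. by move=> p; apply: ereal_sup_ubound; exists l. Qed.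

Lemma curve_length_le g a b (r : \bar R) :
  (forall l, itv_partition a b l -> (curve_variation g a b l)%:E <= r)%E ->
  (curve_length g a b <= r)%E.
Proof. by move=> H; apply: ge_ereal_sup => _ [l /H ? <-]. Qed.

Lemma curve_length_ge_dist g a b : a <= b ->
  (`|g b - g a|%:E <= curve_length g a b)%E.
Proof.
rewrite le_eqVlt => /predU1P[->|ab].
  rewrite subrr normr0 -(curve_variation_nil g b b); apply: curve_length_ub.
  by split => //=.
have := curve_length_ub g (itv_partition1 ab).
by rewrite curve_variation_cons curve_variation_nil addr0.
Qed.

Lemma curve_length_ge0 g a b : a <= b -> (0 <= curve_length g a b)%E.
Proof. by move=> ab; apply: le_trans (curve_length_ge_dist g ab); rewrite lee_fin. Qed.

Lemma curve_length_lipschitz g a b (k : R) : a <= b ->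
  (forall s t, a <= s -> s <= t -> t <= b -> `|g t - g s| <= k * (t - s)) ->
  (curve_length g a b <= (k * (b - a))%:E)%E.
Proof.
move=> ab H; apply: curve_length_le => l pl; rewrite lee_fin.
elim: l a ab H pl => [|x l IH] a ab H pl.
  by rewrite curve_variation_nil (itv_partition_nil pl) subrr mulr0.
have ax : a < x by case: pl => /= /andP[].
have pxl := itv_partition_cons pl; have xb := itv_partition_le pxl.
rewrite curve_variation_cons.
have h1 : `|g x - g a| <= k * (x - a) by apply: H => //; exact: ltW.
have h2 : curve_variation g x b l <= k * (b - x).
  by apply: IH => // s t xs; apply: H; apply: le_trans xs; exact: ltW.
by apply: le_trans (lerD h1 h2) _; rewrite -mulrDr addrC subrKA.
Qed.

Lemma curve_length_superadditive g a b c : a <= b -> b <= c ->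
  (curve_length g a b + curve_length g b c <= curve_length g a c)%E.
Proof.
move=> ab bc.
have [->|acy] := eqVneq (curve_length g a c) +oo%E; first exact: leey.
have acf : curve_length g a c \is a fin_num.
  by rewrite fin_numE acy gt_eqF // (lt_le_trans _ (curve_length_ge0 g (le_trans ab bc))) // ltNy0.
have H l : itv_partition a b l ->
    ((curve_variation g a b l)%:E + curve_length g b c <= curve_length g a c)%E.
  move=> pl; rewrite -leeBrDl //; apply: curve_length_le => l' pl'.
  rewrite leeBrDl //; apply: le_trans (curve_length_ub g (itv_partition_cat pl pl')).
  rewrite curve_variation_cat; case: pl => _ /eqP ->.
  by rewrite (curve_variation_default _ _ b c).
have bcf : curve_length g b c \is a fin_num.
  rewrite ge0_fin_numE ?curve_length_ge0 //.
  have [l pl] : exists l, itv_partition a b l.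
    move: ab; rewrite le_eqVlt => /predU1P[->|ab]; last by exists [:: b]; exact: itv_partition1.
    by exists [::]; split => //=.
  have := H l pl; rewrite -leeBrDl // => /le_lt_trans; apply.
  by rewrite -ge0_fin_numE ?fin_numB ?acf // (le_trans _ (_ : curve_length g b c <= _)%E) ?curve_length_ge0 // leeBrDl // H.
rewrite -leeBrDr //; apply: curve_length_le => l pl; rewrite leeBrDr //; exact: H.
Qed.

(** Induction on the partition: its points up to [b] are split off one at a time, and in the first
    step beyond [b] the point [b] is inserted by the triangle inequality. *)
Lemma curve_length_subadditive g a b c : a <= b -> b <= c ->
  (curve_length g a c <= curve_length g a b + curve_length g b c)%E.
Proof.
move=> ab bc; apply: curve_length_le => l pl.
elim: l a ab pl => [|x l IH] a ab pl.
  by rewrite curve_variation_nil adde_ge0 // curve_length_ge0.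
have ax : a < x by case: pl => /= /andP[].
have pxl := itv_partition_cons pl; rewrite curve_variation_cons EFinD.
have [xb|bx] := leP x b.
  apply: le_trans (leeD2l _ (IH _ xb pxl)) _; rewrite addeA leeD2r //.
  apply: le_trans (curve_length_superadditive g (ltW ax) xb).
  by rewrite leeD2r // curve_length_ge_dist // ltW.
have h1 := curve_length_ge_dist g ab.
have pb : itv_partition b c (x :: l).
  by case: pl => /= /andP[_ ?] ?; split => //=; rewrite bx.
have := curve_length_ub g pb; rewrite curve_variation_cons EFinD => h2.
apply: le_trans (leeD h1 h2); rewrite -!EFinD lee_fin addrA lerD2r addrC.
exact: ler_distD.
Qed.

(** Additivity of length in real-valued form: from here on a rectifiable curve is handled through
    the length [L] travelled from [a]. *)
Lemma curve_length_real g a b : a <= b -> rectifiable g a b ->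
  exists2 L : R -> R, L a = 0 &
    forall s t, a <= s -> s <= t -> t <= b -> curve_length g s t = (L t - L s)%:E.
Proof.
move=> ab rg; exists (fun t => fine (curve_length g a t)).
  suff -> : curve_length g a a = 0%E by [].
  apply/eqP; rewrite eq_le curve_length_ge0 // andbT; apply: curve_length_le => l.
  by move=> /itv_partitionxx ->; rewrite curve_variation_nil.
move=> s t as_ st tb.
have asx := curve_length_superadditive g as_ st.
have asy := curve_length_subadditive g as_ st.
have aby := curve_length_superadditive g (le_trans as_ st) tb.
have f1 : curve_length g a t \is a fin_num.
  rewrite ge0_fin_numE ?curve_length_ge0 ?(le_trans as_) //.
  apply: le_lt_trans rg; apply: le_trans aby; rewrite leeDl //.
  exact: curve_length_ge0.
have f2 : curve_length g a s \is a fin_num.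
  rewrite ge0_fin_numE ?curve_length_ge0 //.
  rewrite ge0_fin_numE ?curve_length_ge0 ?(le_trans as_) // in f1.
  apply: le_lt_trans f1; apply: le_trans asx; rewrite leeDl //.
  exact: curve_length_ge0.
have f3 : curve_length g s t \is a fin_num.
  rewrite ge0_fin_numE ?curve_length_ge0 //.
  rewrite ge0_fin_numE ?curve_length_ge0 ?(le_trans as_) // in f1.
  apply: le_lt_trans f1; apply: le_trans asx; rewrite leeDr //.
  exact: curve_length_ge0.
have /eqP : (curve_length g a s + curve_length g s t = curve_length g a t)%E.
  by apply/eqP; rewrite eq_le asx asy.
rewrite -(fineK f1) -(fineK f2) -(fineK f3) -EFinD eqe /= => /eqP <-.
by rewrite addrAC subrr add0r.
Qed.

End CurveLength.

(** * Parametrization by arc length *)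

Section Arclength.
Context {R : realType} {E : normedModType R}.
Variables (g : R -> E) (a b : R) (L : R -> R).
Hypotheses (ab : a <= b) (cg : {within `[a, b], continuous g}).
Hypothesis La : L a = 0.
Hypothesis LE : forall s t, a <= s -> s <= t -> t <= b ->
  curve_length g s t = (L t - L s)%:E.

Lemma arclength_mono s t : a <= s -> s <= t -> t <= b -> L s <= L t.
Proof.
move=> as_ st tb; rewrite -subr_ge0 -lee_fin -LE //; exact: curve_length_ge0.
Qed.

Lemma arclength_dist s t : a <= s -> s <= t -> t <= b -> `|g t - g s| <= L t - L s.
Proof.
by move=> as_ st tb; rewrite -lee_fin -LE //; exact: curve_length_ge_dist.
Qed.

(** Take a partition of [[t, b]] whose variation is within e/2 of the length. Moving its start to a
    nearby [u] lowers the variation by less than e/2, so the length between [t] and [u] is at most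
    e. *)
Lemma arclength_right_continuous t e : a <= t -> t < b -> 0 < e ->
  exists2 u, t < u <= b & L u <= L t + e.
Proof.
move=> at_ tb e0; have e20 : 0 < e / 2 by lra.
have lenE := LE at_ (ltW tb) (lexx b).
have := @ub_ereal_sup_adherent R
  [set (curve_variation g t b s)%:E | s in itv_partition t b] _ e20.
rewrite -/(curve_length g t b) lenE => /(_ isT)[_ [[|x l] pl <-]].
  by move: (itv_partition_nil pl) tb => ->; rewrite ltxx.
rewrite curve_variation_cons lte_fin => hl.
have tx : t < x by case: pl => /= /andP[].
have xb := itv_partition_le (itv_partition_cons pl).
have [|r r0 Hr] := (iffLR (within_continuousP _ _) cg) t _ _ e20.
  by rewrite /= in_itv /= at_ ltW.
pose u := Num.min (t + r / 2) ((t + x) / 2).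
have tu : t < u by rewrite lt_min; lra.
have ux : u < x by rewrite gt_min; apply/orP; right; lra.
have ub : u <= b by lra.
exists u; first by rewrite tu.
have h1 : `|g t - g u| < e / 2.
  apply: Hr; first by rewrite /= in_itv /= ub andbT; lra.
  rewrite ltr_norml; apply/andP; split; last lra.
  have : u <= t + r / 2 by rewrite ge_min lexx.
  lra.
have : itv_partition u b (x :: l) by case: pl => /= /andP[_ ?] ?; split => //=; rewrite ux.
move=> /(curve_length_ub g); rewrite LE //; last lra.
rewrite curve_variation_cons lee_fin.
have := ler_distD (g u) (g x) (g t); rewrite (distrC (g u)); lra.
Qed.

(* The parameter selected by [arclength_param]. *)
Definition hitting_time s : R :=
  inf [set t | t \in `[a, b] /\ (s%:E <= curve_length g a t)%E].

Lemma hitting_timeP s : 0 <= s -> s <= L b ->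
  [/\ a <= hitting_time s, hitting_time s <= b, s <= L (hitting_time s) &
      forall t, a <= t -> t < hitting_time s -> L t < s].
Proof.
move=> s0 sL; rewrite /hitting_time; set S := [set t | _].
have SE t : S t <-> a <= t <= b /\ s <= L t.
  rewrite /S /= in_itv /=; split => -[/andP[at_ tb]]; rewrite LE // La subr0 lee_fin.
    by rewrite at_ tb.
  by rewrite at_ tb.
have Sb : S b by apply/SE; rewrite ab lexx.
have Slb : lbound S a by move=> t /SE[/andP[]].
have hinf : has_inf S by split; [exists b|exists a].
have ainf : a <= inf S by apply: lb_le_inf => //; exists b.
have infb : inf S <= b by apply: ge_inf => //; exists a.
have below t : a <= t -> t < inf S -> L t < s.
  move=> at_ tS; rewrite ltNge; apply/negP => sLt.
  suff /(ge_inf (ex_intro _ a Slb)) : S t by rewrite leNgt tS.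
  by apply/SE; rewrite at_; split => //; lra.
split => //.
move: infb; rewrite le_eqVlt => /predU1P[->//|infb].
rewrite leNgt; apply/negP => h.
have e0 : 0 < (s - L (inf S)) / 2 by lra.
have [u /andP[u1 u2] Lu] := arclength_right_continuous ainf infb e0.
have : u <= inf S.
  apply: lb_le_inf; first by exists b.
  move=> t /SE[/andP[at_ tb] sLt]; rewrite leNgt; apply/negP => tu.
  have := arclength_mono at_ (ltW tu) u2; lra.
by rewrite leNgt u1.
Qed.

(** Just before the hitting time of [t] the length travelled is below [t], while at the hitting time
    of [s] it has reached [s]; continuity of [g] carries the bound over to the hitting time of
    [t]. *)
Lemma arclength_param_lipschitz s t : 0 <= s -> s <= t -> t <= L b ->
  `|arclength_param g a b t - arclength_param g a b s| <= t - s.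
Proof.
move=> s0 st tL; rewrite /arclength_param -!/(hitting_time _).
have [s1 s2 s3 s4] := hitting_timeP s0 (le_trans st tL).
have [t1 t2 t3 t4] := hitting_timeP (le_trans s0 st) tL.
set u := hitting_time s in s1 s2 s3 s4 *; set v := hitting_time t in t1 t2 t3 t4 *.
have [uv|] := ltP u v; last first.
  rewrite le_eqVlt => /predU1P[->|vu]; first by rewrite subrr normr0 subr_ge0.
  by have := s4 _ t1 vu; lra.
apply/ler_addgt0Pr => e e0.
have [|r r0 Hr] := (iffLR (within_continuousP _ _) cg) v _ _ e0.
  by rewrite /= in_itv /= t1.
pose w := Num.max u (v - r / 2).
have uw : u <= w by rewrite le_max lexx.
have wv : w < v by rewrite gt_max uv; lra.
have h1 : `|g v - g w| < e.
  apply: Hr; first by rewrite /= in_itv /=; lra.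
  have : v - r / 2 <= w by rewrite le_max lexx orbT.
  rewrite ltr_norml; lra.
have := arclength_dist s1 uw (ltW (lt_le_trans wv t2)).
have := t4 w (le_trans s1 uw) wv.
have := ler_distD (g w) (g v) (g u); lra.
Qed.

(** The hitting time of [L t] may precede [t], but no length is travelled in between, so [g] agrees
    at both. *)
Lemma arclength_paramE t : a <= t -> t <= b -> arclength_param g a b (L t) = g t.
Proof.
move=> at_ tb; rewrite /arclength_param -/(hitting_time _).
have Lt0 : 0 <= L t by rewrite -La; exact: arclength_mono.
have [t1 t2 t3 t4] := hitting_timeP Lt0 (arclength_mono at_ tb (lexx b)).
set u := hitting_time _ in t1 t2 t3 t4 *.
have ut : u <= t by rewrite leNgt; apply/negP => /(t4 _ at_); rewrite ltxx.
have := arclength_dist t1 ut tb.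
have := arclength_mono t1 ut tb => h1 h2.
by apply/esym/eqP; rewrite -subr_eq0 -normr_le0; lra.
Qed.

Lemma arclength_param_image s : 0 <= s -> s <= L b ->
  exists2 t, t \in `[a, b] & arclength_param g a b s = g t.
Proof.
move=> s0 sL; have [t1 t2 _ _] := hitting_timeP s0 sL.
by exists (hitting_time s) => //; rewrite in_itv /= t1.
Qed.

End Arclength.
(* No measurability is needed: the integral of a nonnegative function is a
   supremum over the simple functions below it. *)
Lemma ge0_le_integral_subset (d : measure_display) (T : measurableType d)
    (R : realType) (mu : {measure set T -> \bar R}) (D1 D2 : set T)
    (f1 f2 : T -> \bar R) :
  D1 `<=` D2 -> (forall x, D1 x -> 0 <= f1 x)%E -> (forall x, D2 x -> 0 <= f2 x)%E ->
  (forall x, D1 x -> f1 x <= f2 x)%E ->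
  (\int[mu]_(x in D1) f1 x <= \int[mu]_(x in D2) f2 x)%E.
Proof.
move=> D12 f10 f20 f12; rewrite !ge0_integralE //.
apply: ereal_sup_le => _ [h /= hf <-]; exists h => //= x.
apply: le_trans (hf x) _; rewrite !patchE.
case: (boolP (x \in D1)) => [/set_mem D1x|_].
  by rewrite mem_set ?f12 //; exact: D12.
by case: ifPn => // /set_mem /f20.
Qed.

(* The cases q = 1 and q = -1 handle lengths counted from either end. *)
Lemma integral_inv_affine (R : realType) (p q s : R) : 0 < p -> 0 < p + q * s ->
  q * q = 1 -> 0 < s ->
  (\int[lebesgue_measure]_(x in [set` `[0%R, s]]) ((p + q * x)^-1)%R%:E)%E =
    (q * ln (p + q * s) - q * ln p)%:E.
Proof.
move=> p0 ps qq s0.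
have pos x : 0 <= x -> x <= s -> 0 < p + q * x.
  move=> x0 xs; suff : 0 < s * (p + q * x) by rewrite pmulr_rgt0.
  have -> : s * (p + q * x) = (s - x) * p + x * (p + q * s) by ring.
  have [->|xn] := eqVneq x 0; first by rewrite subr0 mul0r addr0 mulr_gt0.
  by rewrite ltr_wpDl // ?mulr_ge0 ?subr_ge0 ?(ltW p0) // mulr_gt0 // lt0r xn.
have dF x : 0 <= x -> x <= s -> is_derive x (1 : R) (fun x => q * ln (p + q * x)) (p + q * x)^-1.
  move=> x0 xs.
  have h := is_derive1_ln (pos x x0 xs).
  have -> : (p + q * x)^-1 = q * ((p + q * x)^-1 * q) by rewrite mulrCA qq mulr1.
  have hg : is_derive x (1 : R) (fun x => p + q * x) q.
    have := is_deriveD (is_derive_cst p x 1) (is_deriveZ q (is_derive_id x (1 : R))).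
    by rewrite /GRing.scale /= add0r mulr1.
  have hc := @is_derive1_comp R (@ln R) (fun x => p + q * x) x _ _ h hg.
  by have := @is_deriveZ _ _ _ _ q _ _ _ hc; rewrite /GRing.scale /=.
have cF x : 0 <= x -> x <= s -> {for x, continuous (fun x => q * ln (p + q * x))}.
  move=> x0 xs; apply/differentiable_continuous/derivable1_diffP.
  by have [] := dF x x0 xs.
rewrite (@continuous_FTC2 _ _ (fun x => q * ln (p + q * x))) ?mulr0 ?addr0 //.
- apply/subspace_continuousP => x; rewrite /= in_itv /= => /andP[x0 xs].
  apply: cvg_within_filter.
  apply: cvgV; first by rewrite gt_eqF // pos.
  apply: cvgD; first exact: cvg_cst.
  by apply: cvgM; [exact: cvg_cst|exact: cvg_id].
- split.
  + move=> x; rewrite in_itv /= => /andP[/ltW x0 /ltW xs].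
    by have [] := dF x x0 xs.
  + apply: cvg_at_right_filter; exact: (cF 0 (lexx 0) (ltW s0)).
  + apply: cvg_at_left_filter; exact: (cF s (ltW s0) (lexx s)).
- move=> x; rewrite in_itv /= => /andP[/ltW x0 /ltW xs].
  rewrite derive1E; have h := dF x x0 xs; exact: derive_val.
Qed.

(** * Estimates for the quasihyperbolic distance *)

Section Quasihyperbolic.
Context {R : realType} {E : normedModType R}.
Implicit Types (g : R -> E) (G : set E) (a b s t d l K : R) (x y : E).

Lemma qhyp_le_curve G g a b d l : curve_in G g a b -> 0 < d ->
  (curve_length g a b <= l%:E)%E -> (forall t, t \in `[a, b] -> d <= bdist G (g t)) ->
  (qhyp G (g a) (g b) <= (l / d)%:E)%E.
Proof.
move=> [ab cg Gg] d0 gl Hd.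
have rg : rectifiable g a b by apply: le_lt_trans gl _; rewrite ltry.
have [L La LE] := curve_length_real ab rg.
rewrite LE // La subr0 lee_fin in gl.
have L0 : 0 <= L b by rewrite -La; exact: (arclength_mono LE).
apply: ge_ereal_inf; exists (line_integral (fun z => (bdist G z)^-1)%R g a b).
  by exists g, a, b.
rewrite /line_integral LE // La subr0 /=.
have pos s : 0 <= s -> s <= L b -> d <= bdist G (arclength_param g a b s).
  by move=> s0 sL; have [t tab ->] := arclength_param_image ab cg La LE s0 sL; exact: Hd.
apply: le_trans (_ : \int[lebesgue_measure]_(s in [set` `[0%R, L b]]) (d^-1)%:E <= _)%E.
  apply: ge0_le_integral_subset => // s; rewrite /= in_itv /= => /andP[s0 sL].
  - by rewrite lee_fin invr_ge0 (le_trans (ltW d0)) // pos.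
  - by rewrite lee_fin invr_ge0 ltW.
  - by rewrite lee_fin lef_pV2 ?posrE ?pos // (lt_le_trans d0) // pos.
rewrite integral_cst //= lebesgue_measure_itv /= lte_fin.
case: ltP => [h|h]; last by rewrite mule0 lee_fin divr_ge0 ?(ltW d0) // (le_trans L0).
by rewrite oppr0 adde0 -EFinM lee_fin mulrC ler_wpM2r // invr_ge0 ltW.
Qed.

Lemma qhyp_le_segment G x y d : seg x y `<=` G -> 0 < d ->
  (forall z, seg x y z -> d <= bdist G z) -> (qhyp G x y <= (`|x - y| / d)%:E)%E.
Proof.
move=> sG d0 Hd.
have Hs t : t \in `[0, 1] -> seg x y (segpt x y t) by exists t.
have := @qhyp_le_curve G (segpt x y) 0 1 d `|x - y|; rewrite segpt0 segpt1; apply => //.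
- split; [exact: ler01|exact: segpt_continuous|].
  by move=> t /Hs /sG.
- rewrite -[X in (_ <= X%:E)%E]mulr1 -{2}(subr0 1); apply: curve_length_lipschitz => //.
  move=> s t _ st _; rewrite segpt_dist mulrC ger0_norm ?subr_ge0 //.
- by move=> t /Hs /Hd.
Qed.

Section LowerBound.
Variables (G : set E) (g : R -> E) (a b : R) (L : R -> R).
Hypotheses (dG : is_domain G) (pG : G != [set: E]).
Hypotheses (cG : curve_in G g a b) (La : L a = 0).
Hypothesis LE : forall s t, a <= s -> s <= t -> t <= b ->
  curve_length g s t = (L t - L s)%:E.

Lemma line_integral_ge p q s : 0 < p -> 0 < p + q * s -> q * q = 1 ->
  0 <= s -> s <= L b ->
  (forall u, 0 <= u -> u <= s -> bdist G (arclength_param g a b u) <= p + q * u) ->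
  ((q * ln (p + q * s) - q * ln p)%:E <=
    line_integral (fun z => (bdist G z)^-1)%R g a b)%E.
Proof.
have [ab cg Gg] := cG.
move=> p0 ps qq s0 sL H; rewrite /line_integral LE // La subr0 /=.
have pos u : 0 <= u -> u <= L b -> 0 < bdist G (arclength_param g a b u).
  move=> u0 uL; have [t tab ->] := arclength_param_image ab cg La LE u0 uL.
  by apply: bdist_gt0 => //; exact: Gg.
have [->|sn0] := eqVneq s 0.
  rewrite mulr0 addr0 subrr; apply: integral_ge0 => u; rewrite /= in_itv /= => /andP[? ?].
  by rewrite lee_fin invr_ge0 ltW // pos.
rewrite -integral_inv_affine // ?lt0r ?sn0 //.
have pos' u : 0 <= u -> u <= s -> 0 < p + q * u.
  by move=> u0 us; apply: lt_le_trans (H u u0 us); apply: pos => //; exact: le_trans us sL.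
apply: ge0_le_integral_subset => u; rewrite /= !in_itv /= => /andP[u0 us].
- by rewrite u0 /= (le_trans us).
- by rewrite lee_fin invr_ge0 ltW // pos'.
- by rewrite lee_fin invr_ge0 ltW // pos.
- have us' := le_trans us sL.
  by rewrite lee_fin lef_pV2 ?posrE ?pos' ?pos // H.
Qed.

(** At arc length u up to [L t] the boundary distance is at most bdist (g a) + u, and at most bdist
    (g t) + L t - u. Integrating the inverses of these two bounds gives logarithms, and hence the
    two inequalities. *)
Lemma line_integral_bounds K t : a <= t -> t <= b ->
  (line_integral (fun z => (bdist G z)^-1)%R g a b <= K%:E)%E ->
  L t <= expR K * bdist G (g a) /\ bdist G (g a) <= expR K * bdist G (g t).
Proof.
have [ab cg Gg] := cG => at_ tb HK.
have Lt0 : 0 <= L t by rewrite -La; exact: (arclength_mono LE).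
have LtL : L t <= L b by exact: (arclength_mono LE).
have ga : 0 < bdist G (g a) by apply: bdist_gt0 => //; apply: Gg; rewrite in_itv /= lexx.
have gt : 0 < bdist G (g t) by apply: bdist_gt0 => //; apply: Gg; rewrite in_itv /= at_.
have lip u v : 0 <= u -> u <= v -> v <= L b ->
    `|arclength_param g a b v - arclength_param g a b u| <= v - u.
  exact: (arclength_param_lipschitz ab cg La LE).
have e0 : arclength_param g a b 0 = g a.
  by rewrite -La; apply: (arclength_paramE ab cg La LE).
have et : arclength_param g a b (L t) = g t by apply: (arclength_paramE ab cg La LE).
have expK p r : 0 < p -> 0 < r -> ln r - ln p <= K -> r <= expR K * p.
  move=> p0 r0; rewrite lerBlDr -ler_expR expRD !lnK ?posrE //.
have d0t : 0 < bdist G (g t) + L t by exact: ltr_wpDr.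
have da : bdist G (g a) <= bdist G (g t) + L t.
  have := lip 0 (L t) (lexx 0) Lt0 LtL; rewrite et e0 subr0 distrC.
  have := bdist_lip dG pG (g a) (g t); lra.
split.
- have H : ((1 * ln (bdist G (g a) + 1 * L t) - 1 * ln (bdist G (g a)))%:E <=
      line_integral (fun z => (bdist G z)^-1)%R g a b)%E.
    apply: line_integral_ge => //; rewrite ?mul1r ?ltr_wpDr //.
    move=> u u0 us; have := lip 0 u (lexx 0) u0 (le_trans us LtL).
    rewrite e0 subr0 mul1r; have := bdist_lip dG pG (arclength_param g a b u) (g a); lra.
  have := le_trans H HK; rewrite !mul1r lee_fin => /expK h.
  have := h ga (ltr_wpDr Lt0 ga); lra.
- have H : ((- 1 * ln (bdist G (g t) + L t + - 1 * L t) - - 1 * ln (bdist G (g t) + L t))%:E <=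
      line_integral (fun z => (bdist G z)^-1)%R g a b)%E.
    apply: line_integral_ge => //; rewrite ?mulN1r ?addrK ?opprK //.
    move=> u u0 us; have := lip u (L t) u0 us LtL.
    rewrite et mulN1r distrC.
    have := bdist_lip dG pG (arclength_param g a b u) (g t); lra.
  have := le_trans H HK; rewrite !mulN1r addrK opprK lee_fin addrC => /expK h.
  by apply: le_trans da _; exact: h.
Qed.
End LowerBound.
End Quasihyperbolic.

(** * Chains of points *)

Section Chains.
Context {R : realType} {E : normedModType R}.
Implicit Types (G : set E) (x y z p : E) (l : seq E) (K : R).

(** Steps so short that an arc built from them stays within a quarter of the boundary distance of
    some vertex, hence in [G]. The condition is symmetric, so that chains can be reversed. *)
Definition fine_step G x y : bool :=
  (`|x - y| <= bdist G x / 4) && (`|x - y| <= bdist G y / 4).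

Fixpoint chain_length x l : R :=
  if l is y :: l' then `|x - y| + chain_length y l' else 0.

Lemma chain_length_ge0 x l : 0 <= chain_length x l.
Proof. by elim: l x => //= y l IH x; rewrite addr_ge0. Qed.

Lemma chain_length_cat x l l' :
  chain_length x (l ++ l') = chain_length x l + chain_length (last x l) l'.
Proof. by elim: l x => [|y l IH] x /=; rewrite ?add0r // IH addrA. Qed.

Lemma chain_mkseq G (p : nat -> E) (h : R) n m :
  (forall i, (m <= i < m + n)%N -> fine_step G (p i) (p i.+1) /\ `|p i - p i.+1| <= h) ->
  [/\ path (fine_step G) (p m) [seq p i | i <- iota m.+1 n],
      last (p m) [seq p i | i <- iota m.+1 n] = p (m + n)%N &
      chain_length (p m) [seq p i | i <- iota m.+1 n] <= h *+ n].
Proof.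
elim: n m => [|n IH] m H /=; first by rewrite addn0.
have [h1 h2] := H m ltac:(by rewrite leqnn addnS ltnS leq_addr).
have [|p1 p2 p3] := IH m.+1.
  by move=> i /andP[mi ni]; apply: H; rewrite (ltnW mi) -addSnnS.
by rewrite h1 p1 p2 -addSnnS mulrS lerD.
Qed.

Section QhypBounds.
Variable G : set E.
Hypotheses (dG : is_domain G) (pG : G != [set: E]).

Lemma qhyp_curve x y K : (qhyp G x y <= K%:E)%E ->
  exists g a b (L : R -> R),
    [/\ curve_in G g a b, g a = x, g b = y, L a = 0 &
     (forall s t, a <= s -> s <= t -> t <= b -> curve_length g s t = (L t - L s)%:E) /\
     forall t, a <= t -> t <= b ->
       L t <= expR (K + 1) * bdist G x /\ bdist G x <= expR (K + 1) * bdist G (g t)].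
Proof.
move=> xy.
(* The infimum need not be attained, so a curve with integral below K + 1 is taken. This is the
   source of the constants [expR (K + 1)]. *)
have : (qhyp G x y < (K + 1)%:E)%E by apply: le_lt_trans xy _; rewrite lte_fin ltrDl.
move=> /ereal_inf_lt[I [g [a [b [cG rg <- <- ->]]]]] /ltW hI.
have [ab _ _] := cG.
have [L La LE] := curve_length_real ab rg.
exists g, a, b, L; split => //; split => // t at_ tb.
exact: (line_integral_bounds dG pG cG La LE).
Qed.

Lemma qhyp_dist x y K : (qhyp G x y <= K%:E)%E ->
  `|x - y| <= expR (K + 1) * bdist G x /\ bdist G x <= expR (K + 1) * bdist G y.
Proof.
move=> /qhyp_curve[g [a [b [L [[ab _ _] <- <- La [LE H]]]]]].
have [h1 h2] := H b ab (lexx b); split => //.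
have := arclength_dist LE (lexx a) ab (lexx b); rewrite distrC La; lra.
Qed.

Lemma qhyp_dist_r x y K : (qhyp G x y <= K%:E)%E ->
  `|x - y| <= expR (K + 1) * expR (K + 1) * bdist G y.
Proof.
move=> /qhyp_dist[h1 h2]; apply: le_trans h1 _; by rewrite -mulrA ler_wpM2l.
Qed.

(** With Q = exp (K + 1), the curve of [qhyp_curve] keeps boundary distance at least bdist x / Q; it
    is cut into pieces of equal length, at most a quarter of that. *)
Lemma qhyp_chain x y K : G x -> (qhyp G x y <= K%:E)%E ->
  exists l, [/\ path (fine_step G) x l, last x l = y,
    chain_length x l <= expR (K + 1) * bdist G x &
    forall z, z \in x :: l -> G z /\ bdist G x <= expR (K + 1) * bdist G z].
Proof.
move=> Gx /qhyp_curve[g [a [b [L [[ab cg Gg] ga gb La [LE H]]]]]].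
have Lb0 : 0 <= L b by rewrite -La; exact: (arclength_mono LE).
set Q := expR (K + 1) in H *; have Q0 : 0 < Q by exact: expR_gt0.
have dx0 : 0 < bdist G x by exact: bdist_gt0.
pose c := arclength_param g a b.
have Hc s : 0 <= s -> s <= L b -> G (c s) /\ bdist G x <= Q * bdist G (c s).
  move=> s0 sL; have [t tab hc] := arclength_param_image ab cg La LE s0 sL.
  rewrite /c hc; split; first exact: Gg.
  by move: tab; rewrite in_itv /= => /andP[at_ tb]; have [] := H t at_ tb.
pose n := (Num.truncn (L b / (bdist G x / Q / 4))).+1.
have n0 : 0 < n%:R :> R by rewrite ltr0n.
have hn : L b / n%:R <= bdist G x / Q / 4.
  have := truncnS_gt (L b / (bdist G x / Q / 4)).
  rewrite -/n ltr_pdivrMr ?divr_gt0 // => /ltW h.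
  by rewrite ler_pdivrMr // mulrC.
pose p (i : nat) := c (i%:R * (L b / n%:R)).
have ir i : (i <= n)%N -> 0 <= i%:R * (L b / n%:R) <= L b.
  move=> le_in; rewrite mulr_ge0 ?divr_ge0 ?(ltW n0) //=.
  by rewrite mulrCA ler_piMr // ler_pdivrMr // mul1r ler_nat.
have step i : (i < n)%N -> `|p i - p i.+1| <= L b / n%:R.
  move=> lin; have /andP[h1 h2] := ir i (ltnW lin); have /andP[h3 h4] := ir i.+1 lin.
  rewrite /p distrC.
  apply: le_trans (arclength_param_lipschitz ab cg La LE h1 _ h4) _.
    by rewrite ler_wpM2r ?divr_ge0 ?(ltW n0) // ler_nat.
  by rewrite -mulrBl -natrB // subSnn mul1r.
have dp i : (i <= n)%N -> bdist G x / Q / 4 <= bdist G (p i) / 4.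
  move=> lin; have /andP[h1 h2] := ir i lin; have [_ h] := Hc _ h1 h2.
  by rewrite ler_pM2r // ler_pdivrMr // mulrC.
have [|h1 h2 h3] := @chain_mkseq G p (L b / n%:R) n 0.
  move=> i /andP[_ lin]; split; last exact: step.
  by rewrite /fine_step !(le_trans (step i lin)) // (le_trans hn) ?dp // ltnW.
have p0 : p 0%N = x.
  by rewrite /p mul0r -La /c (arclength_paramE ab cg La LE).
have pn : p n = y.
  by rewrite /p mulrC divfK ?gt_eqF // /c (arclength_paramE ab cg La LE).
rewrite p0 ?add0n pn in h1 h2 h3.
exists [seq p i | i <- iota 1 n]; split => //.
- apply: le_trans h3 _; rewrite -[leLHS]mulr_natr divfK ?gt_eqF //.
  by have [] := H b ab (lexx b).
- move=> z; rewrite in_cons => /predU1P[->|/mapP[i]].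
    have := Hc 0 (lexx 0) Lb0; have := p0; by rewrite /p mul0r => ->.
  rewrite mem_iota => /andP[_ lin] ->.
  by have /andP[? ?] := ir i lin; exact: Hc.
Qed.
End QhypBounds.
End Chains.
(** * Uniform arcs *)

Section UniformArcs.
Context {R : realType} {E : normedModType R}.
Implicit Types (G : set E) (g : R -> E) (x y z : E) (c lam : R).

Lemma rel_distP G x y lam : is_domain G -> G != [set: E] -> G x -> G y ->
  (rel_dist G x y <= lam) = (`|x - y| <= lam * bdist G x) && (`|x - y| <= lam * bdist G y).
Proof.
move=> dG pG Gx Gy; have dx := bdist_gt0 dG pG Gx; have dy := bdist_gt0 dG pG Gy.
rewrite /rel_dist ler_pdivrMr ?lt_min ?dx //.
have [lam0|lam0] := leP 0 lam; first by rewrite minr_pMr // le_min.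
rewrite [LHS]leNgt [X in X && _]leNgt (lt_le_trans _ (normr_ge0 _)) ?(lt_le_trans _ (normr_ge0 _)) //.
  by rewrite nmulr_rlt0.
by rewrite nmulr_rlt0 // lt_min dx.
Qed.

(* [L] is the arc length from the initial point; injectivity plays no role for
   the arcs of the source domain. *)
Definition uniform_curve c G g (a b : R) (L : R -> R) : Prop :=
  [/\ curve_in G g a b, L a = 0,
      forall s t, a <= s -> s <= t -> t <= b -> curve_length g s t = (L t - L s)%:E,
      L b <= c * `|g a - g b| &
      forall t, a <= t -> t <= b -> L t <= c * bdist G (g t) \/ L b - L t <= c * bdist G (g t)].

Lemma uniform_curve_ex c G x y : uniform_domain c G -> G x -> G y ->
  exists g a b L, [/\ g a = x, g b = y & uniform_curve c G g a b L].
Proof.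
move=> uG Gx Gy; have [g [a [b [[[ab cg Gg] _] ga gb lg H]]]] := uG x y Gx Gy.
have rg : rectifiable g a b by apply: le_lt_trans lg _; rewrite ltry.
have [L La LE] := curve_length_real ab rg.
exists g, a, b, L; split => //; split => //.
  by move: lg; rewrite LE // La subr0 lee_fin ga gb.
move=> t at_ tb; have := H t; rewrite in_itv /= at_ tb => /(_ isT).
rewrite !LE // La subr0 ge_min !lee_fin => /orP[]; by [left|right].
Qed.

(** [s], [h], [s'] are the lengths of consecutive subarcs, [w] is the chord of the middle one, and
    [du], [dv] are the boundary distances at its ends. As h is so much larger than w, the bound on
    the total length forces c s or c s' to be at least h / 4. The boundary distance at the adjacent
    end is then at least h / (4 c^2), and the other one differs from it by at most w < h / (8
    c^2). *)
Lemma long_subarc_bound c s s' (h w du dv : R) : 1 <= c ->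
  0 <= s -> 0 <= s' -> 0 <= w -> 0 <= du -> 0 <= dv ->
  8 * c ^+ 2 * w < h -> s + h + s' <= c * (s + w + s') ->
  s <= c * du \/ h + s' <= c * du -> s + h <= c * dv \/ s' <= c * dv ->
  `|du - dv| <= w -> h <= 8 * c ^+ 2 * du /\ h <= 8 * c ^+ 2 * dv.
Proof.
move=> c1 s0 s'0 w0 du0 dv0 wh tot Hu Hv; rewrite ler_norml => /andP[uv1 uv2].
have c0 : 0 <= c by lra.
have cc : c <= c ^+ 2 by rewrite expr2 ler_peMl.
have ccd d : 0 <= d -> c * d <= c ^+ 2 * d by move=> ?; exact: ler_wpM2r.
have cw := ccd w w0; have cdu := ccd du du0; have cdv := ccd dv dv0.
have c2 : 0 <= c ^+ 2 by rewrite exprn_ge0.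
have uw1 := ler_wpM2l c2 uv1; have uw2 := ler_wpM2l c2 uv2.
have mu d r : r <= c * d -> c * r <= c ^+ 2 * d.
  by move=> /(ler_wpM2l c0); rewrite mulrA expr2.
have hh : h <= 2 * (c * s) + 2 * (c * s') by lra.
have [cs|cs] : h <= 4 * (c * s) \/ h <= 4 * (c * s').
  by have [?|?] := leP h (4 * (c * s)); [left|right; lra].
- have : h <= 4 * (c ^+ 2 * du) by case: Hu => [/mu|]; lra.
  split; lra.
- have : h <= 4 * (c ^+ 2 * dv) by case: Hv => [|/mu]; lra.
  split; lra.
Qed.

Section Curve.
Variables (c : R) (G : set E) (g : R -> E) (a b : R) (L : R -> R).
Hypotheses (c1 : 1 <= c) (dG : is_domain G) (pG : G != [set: E]).
Hypothesis ug : uniform_curve c G g a b L.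

Lemma uniform_curve_bdist s t : a <= s -> s <= t -> t <= b ->
  L t - L s <= 8 * c ^+ 2 * `|g s - g t| \/
  (L t - L s <= 8 * c ^+ 2 * bdist G (g s) /\ L t - L s <= 8 * c ^+ 2 * bdist G (g t)).
Proof.
have [[ab cg Gg] La LE Lb Lc] := ug => as_ st tb.
have [?|hw] := leP (L t - L s) (8 * c ^+ 2 * `|g s - g t|); [by left|right].
have sb := le_trans st tb; have at_ := le_trans as_ st.
have mem u : a <= u -> u <= b -> 0 < bdist G (g u).
  by move=> au ub; apply: bdist_gt0 => //; apply: Gg; rewrite in_itv /= au.
apply: (long_subarc_bound c1 (s := L s) (s' := L b - L t) (w := `|g s - g t|)) => //.
- by rewrite -La; exact: (arclength_mono LE).
- by rewrite subr_ge0; exact: (arclength_mono LE).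
- by rewrite ltW // mem.
- by rewrite ltW // mem.
- have h1 := arclength_dist LE (lexx a) as_ sb.
  have h2 := arclength_dist LE at_ tb (lexx b).
  have h3 := ler_distD (g s) (g a) (g b); have h4 := ler_distD (g t) (g s) (g b).
  have -> : L s + (L t - L s) + (L b - L t) = L b by ring.
  have c0 : 0 <= c := le_trans ler01 c1.
  apply: le_trans Lb _; apply: (ler_wpM2l c0).
  rewrite La in h1; rewrite (distrC (g t)) in h4; rewrite (distrC (g s) (g a)) in h1; lra.
- by have [|] := Lc s as_ sb; [left|right; lra].
- by have [|] := Lc t at_ tb; [left; lra|right].
- exact: bdist_dist.
Qed.

(** Along the subarc the boundary distance is at least m / (2 c) for every positive m below those at
    its ends. By [uniform_curve_bdist], m can be the smaller of these if the length is at most 8 c^2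
    times the chord, and the length divided by 8 c^2 otherwise. *)
Lemma uniform_subcurve_qhyp s q t lam : a <= s -> s <= q -> q <= t -> t <= b ->
  `|g s - g t| <= lam * bdist G (g s) -> `|g s - g t| <= lam * bdist G (g t) ->
  (qhyp G (g s) (g q) <= (16 * c ^+ 3 * (1 + lam))%:E)%E.
Proof.
have [[ab cg Gg] La LE Lb Lc] := ug => as_ sq qt tb ls lt.
have st := le_trans sq qt; have qb := le_trans qt tb; have sb := le_trans st tb.
have c0 : 0 < c := lt_le_trans ltr01 c1.
have mem u : a <= u -> u <= b -> 0 < bdist G (g u).
  by move=> au ub; apply: bdist_gt0 => //; apply: Gg; rewrite in_itv /= au.
have ds := mem s as_ sb; have dt := mem t (le_trans as_ st) tb.
have lam0 : 0 <= lam by rewrite -(pmulr_lge0 _ ds) (le_trans _ ls).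
have Lsq := arclength_mono LE as_ sq qb.
have Lqt := arclength_mono LE (le_trans as_ sq) qt tb.
have K0 : 0 < 16 * c ^+ 3 by rewrite mulr_gt0 // exprn_gt0.
(* By the cone condition one end of the subarc is within c bdist (g u) of [g u], so m <= (1 + c)
   bdist (g u). *)
have along m u : 0 < m -> m <= bdist G (g s) -> m <= bdist G (g t) -> s <= u -> u <= t ->
    m / (2 * c) <= bdist G (g u).
  move=> m0 ms mt su ut; have au := le_trans as_ su; have ub := le_trans ut tb.
  have h1 := arclength_dist LE as_ su ub; have h2 := arclength_dist LE au ut tb.
  have h3 := bdist_lip dG pG (g s) (g u); have h4 := bdist_lip dG pG (g t) (g u).
  rewrite (distrC (g s)) in h3.
  have Ls0 : 0 <= L s by rewrite -La; exact: (arclength_mono LE).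
  have Ltb := arclength_mono LE (le_trans as_ st) tb (lexx b).
  have cd : bdist G (g u) <= c * bdist G (g u) by rewrite ler_peMl // ltW // mem.
  rewrite ler_pdivrMr ?mulr_gt0 //.
  by case: (Lc u au ub) => h; lra.
have concl m : 0 < m -> m <= bdist G (g s) -> m <= bdist G (g t) ->
    2 * c * (L q - L s) <= 16 * c ^+ 3 * (1 + lam) * m ->
    (qhyp G (g s) (g q) <= (16 * c ^+ 3 * (1 + lam))%:E)%E.
  move=> m0 ms mt hm.
  apply: le_trans (qhyp_le_curve (d := m / (2 * c)) (l := L q - L s) _ _ _ _) _ => //.
  - split => //.
      apply: continuous_subspaceW cg => u; rewrite /= !in_itv /=; lra.
    by move=> u; rewrite in_itv /= => ?; apply: Gg; rewrite in_itv /=; lra.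
  - by rewrite divr_gt0 // mulr_gt0.
  - by rewrite LE.
  - by move=> u; rewrite in_itv /= => /andP[su uq]; apply: along => //; lra.
  rewrite lee_fin ler_pdivrMr ?divr_gt0 ?mulr_gt0 // mulrA ler_pdivlMr ?mulr_gt0 //.
  by rewrite mulrC.
have [h|[h1 h2]] := uniform_curve_bdist as_ st tb.
- apply: (concl (Num.min (bdist G (g s)) (bdist G (g t)))).
  + by rewrite lt_min ds.
  + by rewrite ge_min lexx.
  + by rewrite ge_min lexx orbT.
  + have : `|g s - g t| <= lam * Num.min (bdist G (g s)) (bdist G (g t)).
      by rewrite minr_pMr // le_min ls.
    set m := Num.min _ _; have m0 : 0 < m by rewrite lt_min ds.
    move=> hm.
    have hm' : L q - L s <= 8 * c ^+ 2 * (lam * m).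
      by apply: le_trans (le_trans h _); [lra|rewrite ler_pM2l // mulr_gt0 // exprn_gt0].
    have := ler_wpM2l (_ : 0 <= 2 * c) hm'.
    have -> : 2 * c * (8 * c ^+ 2 * (lam * m)) = 16 * c ^+ 3 * (lam * m) by ring.
    have : 0 <= 16 * c ^+ 3 * m by rewrite mulr_ge0 // ltW.
    lra.
- have [h0|h0] := ltP 0 (L t - L s); last first.
    apply: (concl (Num.min (bdist G (g s)) (bdist G (g t)))).
    + by rewrite lt_min ds.
    + by rewrite ge_min lexx.
    + by rewrite ge_min lexx orbT.
    + have -> : L q - L s = 0 by lra.
      rewrite mulr0 !mulr_ge0 ?(ltW K0) ?addr_ge0 // ltW // lt_min ds //.
  have C0 : 0 < 8 * c ^+ 2 by rewrite mulr_gt0 // exprn_gt0.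
  apply: (concl ((L t - L s) / (8 * c ^+ 2))).
  + exact: divr_gt0.
  + by rewrite ler_pdivrMr // mulrC.
  + by rewrite ler_pdivrMr // mulrC.
  + rewrite mulrA ler_pdivlMr //.
    have -> : 2 * c * (L q - L s) * (8 * c ^+ 2) = 16 * c ^+ 3 * (L q - L s) by ring.
    rewrite -[leRHS]mulrA (ler_pM2l K0) (le_trans (_ : _ <= L t - L s)) //; first lra.
    by rewrite ler_peMl ?(ltW h0) //; lra.
Qed.

End Curve.

End UniformArcs.
(** * Quasimöbius estimates *)

Section Gauge.
Context {R : realType} (eta : R -> R).
Hypothesis heta : homeo_gauge eta.

Lemma gauge_ge0 t : 0 <= t -> 0 <= eta t.
Proof.
have [g [[fe _] _ _ _ _]] := heta => t0.
by have := fe t; rewrite /= !in_itv /= !andbT => /(_ t0).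
Qed.

Lemma gauge_inj s t : 0 <= s -> 0 <= t -> eta s = eta t -> s = t.
Proof.
have [g [_ k _ _ _]] := heta => s0 t0 st.
by rewrite -(k s) ?st ?k // inE /= in_itv /= andbT.
Qed.

Lemma gauge_continuous a b : 0 <= a -> {within `[a, b], continuous eta}.
Proof.
have [g [_ _ _ ce _]] := heta => a0; apply: continuous_subspaceW ce => t.
by rewrite /= !in_itv /= andbT; lra.
Qed.

Lemma gauge_bounded B : 0 <= B -> exists2 S : R, 0 < S & forall t, 0 <= t <= B -> eta t <= S.
Proof.
move=> B0; have [m /itvP mB Hm] := EVT_max B0 (@gauge_continuous 0 B (lexx 0)).
exists (eta m + 1); first by rewrite ltr_wpDl // gauge_ge0 // mB.
move=> t tB; rewrite (le_trans (Hm t _)) ?in_itv // lerDl //.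
Qed.

(** If the zero [g 0] of [eta] were positive, a small value [v] would be taken on either side of it,
    against injectivity. *)
Lemma gauge0 : eta 0 = 0.
Proof.
have [g [[_ fg] _ k' _ _]] := heta.
have b0 : 0 <= g 0 by have := fg 0; rewrite /= !in_itv /= !andbT; apply.
have eb : eta (g 0) = 0 by rewrite k' // inE /= in_itv /= andbT.
have [//|e0] := eqVneq (eta 0) 0; exfalso.
have e0' : 0 < eta 0 by rewrite lt0r e0 gauge_ge0.
have b1 : 0 <= g 0 + 1 by rewrite addr_ge0.
have e1 : 0 < eta (g 0 + 1).
  rewrite lt0r gauge_ge0 // andbT; apply/negP => /eqP h.
  have /eqP := gauge_inj b1 b0 (etrans h (esym eb)).
  by rewrite -subr_eq0 addrAC subrr add0r oner_eq0.
pose v := Num.min (eta 0) (eta (g 0 + 1)) / 2.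
have v0 : 0 < v by rewrite divr_gt0 // lt_min e0'.
have v1 : v <= eta 0 by rewrite ler_pdivrMr // ge_min; apply/orP; left; lra.
have v2 : v <= eta (g 0 + 1) by rewrite ler_pdivrMr // ge_min; apply/orP; right; lra.
have [||c cI ec] := @IVT R eta 0 (g 0) v b0; first exact: gauge_continuous.
  by rewrite eb ge_min le_max v1 (ltW v0) orbT.
have [|||c' cI' ec'] := @IVT R eta (g 0) (g 0 + 1) v.
- by rewrite lerDl.
- exact: gauge_continuous.
- by rewrite eb ge_min le_max v2 (ltW v0) orbT.
move: cI cI'; rewrite !in_itv /= => /andP[c0 cg] /andP[gc _].
have cc : c = c' by apply: gauge_inj => //; [exact: le_trans gc|rewrite ec].
have : c = g 0 by apply/eqP; rewrite eq_le cg cc gc.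
by move=> h; move: v0; rewrite -ec h eb ltxx.
Qed.

Lemma gauge_small e : 0 < e -> exists2 r : R, 0 < r & forall t, 0 <= t < r -> eta t < e.
Proof.
move=> e0; have c0 := @gauge_continuous 0 1 (lexx 0).
have [|r r0 Hr] := (iffLR (within_continuousP _ _) c0) 0 _ e e0.
  by rewrite /= in_itv /= lexx ler01.
exists (Num.min r 1); first by rewrite lt_min r0 ltr01.
move=> t /andP[t0]; rewrite lt_min => /andP[tr t1].
have := Hr t; rewrite /= in_itv /= t0 (ltW t1) => /(_ isT).
rewrite !sub0r normrN ger0_norm // => /(_ tr).
by rewrite gauge0 sub0r normrN ger0_norm // gauge_ge0.
Qed.
End Gauge.

Section Quasimobius.
Context {R : realType} (eta : R -> R).
Hypothesis heta : homeo_gauge eta.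

(* The cross ratio of the lemma and that of [quasimobius_rel] are inverse to
   each other, so an upper bound for the image yields one for the source. *)
Let quasimobius_source_bound (k e : R) :
  0 < e -> (forall t, 0 <= t < e^-1 -> k * eta t < 1) ->
  forall (E E' : normedModType R) (X A : set E) (f : E -> E'),
    quasimobius_rel eta X A f -> {in X &, injective f} ->
    forall x y p w, X x -> X y -> A p -> A w -> uniq [:: x; p; w; y] ->
    `|f x - f p| * `|f y - f w| <= k * (`|f x - f w| * `|f y - f p|) ->
    `|x - p| * `|y - w| <= e * (`|x - w| * `|y - p|).
Proof.
move=> e0 ke E E' X A f [AX _ qm] inj x y p w Xx Xy Ap Aw u.
(* With [p] and [w] in the two middle positions the quadruple is admissible. *)
have := qm x p w y Xx (AX _ Ap) (AX _ Aw) Xy u (or_intror (conj Ap Aw)).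
rewrite /cross_ratio => H h'; rewrite leNgt; apply/negP => h.
have [Xp Xw] : X p /\ X w by split; exact: AX.
move: u; rewrite /= !inE !negb_or => /and4P[/and3P[xp xw xy] /andP[pw py] wy _].
have pos (a b : E) : a != b -> 0 < `|a - b| by rewrite normr_gt0 subr_eq0.
have pos' a b : X a -> X b -> a != b -> 0 < `|f a - f b|.
  move=> Xa Xb; rewrite normr_gt0 subr_eq0; apply: contraNneq => fab.
  by apply/eqP; apply: inj; rewrite ?inE.
have xp0 := pos _ _ xp; have xw0 := pos _ _ xw.
have py0 := pos _ _ py; have wy0 := pos _ _ wy.
have xp0' := pos' _ _ Xx Xp xp; have xw0' := pos' _ _ Xx Xw xw.
have py0' := pos' _ _ Xp Xy py; have wy0' := pos' _ _ Xw Xy wy.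
rewrite (distrC y w) (distrC y p) in h; rewrite (distrC (f y) (f w)) (distrC (f y)) in h'.
set t' := _ * _ in H; set t := _ * _ in H.
have t0 : 0 <= t by rewrite mulr_ge0 // divr_ge0.
have te : t < e^-1.
  have -> : t = (`|x - w| * `|p - y|) / (`|x - p| * `|w - y|).
    by rewrite /t mulf_div.
  by rewrite ltr_pdivrMr ?mulr_gt0 // ltr_pdivlMl.
have k0 : 0 < k.
  rewrite -(pmulr_lgt0 _ (mulr_gt0 xw0' py0')); apply: lt_le_trans h'.
  exact: mulr_gt0.
have : 1 <= k * t'.
  have -> : t' = (`|f x - f w| * `|f p - f y|) / (`|f x - f p| * `|f w - f y|).
    by rewrite /t' mulf_div.
  by rewrite mulrA ler_pdivlMr ?mulr_gt0 // mul1r.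
move=> /le_trans /(_ (ler_wpM2l (ltW k0) H)).
by have := ke t; rewrite t0 te => /(_ isT); case: ltP.
Qed.

(** If [eta] is bounded by S on [0, 1/e], then k eta < 1 there for k = 1 / (S + 1). *)
Lemma quasimobius_source_small (e : R) : 0 < e -> exists2 k : R, 0 < k &
  forall (E E' : normedModType R) (X A : set E) (f : E -> E'),
    quasimobius_rel eta X A f -> {in X &, injective f} ->
    forall x y p w, X x -> X y -> A p -> A w -> uniq [:: x; p; w; y] ->
    `|f x - f p| * `|f y - f w| <= k * (`|f x - f w| * `|f y - f p|) ->
    `|x - p| * `|y - w| <= e * (`|x - w| * `|y - p|).
Proof.
move=> e0; have ei : 0 <= e^-1 by rewrite invr_ge0 ltW.
have [S S0 HS] := gauge_bounded heta ei.
exists (S + 1)^-1; first by rewrite invr_gt0 addr_gt0.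
apply: quasimobius_source_bound => // t /andP[t0 te].
rewrite ltr_pdivrMl ?addr_gt0 // mulr1.
by apply: le_lt_trans (HS t _) _; rewrite ?ltrDl // t0 ltW.
Qed.

(** As [eta] tends to 0 at 0, it is below 1/k on some [0, r), and e = 1/r serves. *)
Lemma quasimobius_source_bounded (k : R) : 0 < k -> exists2 e : R, 0 < e &
  forall (E E' : normedModType R) (X A : set E) (f : E -> E'),
    quasimobius_rel eta X A f -> {in X &, injective f} ->
    forall x y p w, X x -> X y -> A p -> A w -> uniq [:: x; p; w; y] ->
    `|f x - f p| * `|f y - f w| <= k * (`|f x - f w| * `|f y - f p|) ->
    `|x - p| * `|y - w| <= e * (`|x - w| * `|y - p|).
Proof.
move=> k0; have ki : 0 < k^-1 by rewrite invr_gt0.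
have [r r0 Hr] := gauge_small heta ki.
exists r^-1; first by rewrite invr_gt0.
apply: quasimobius_source_bound => [|t]; first by rewrite invr_gt0.
by rewrite invrK => /Hr; rewrite -ltr_pdivlMl // mulr1.
Qed.
End Quasimobius.

(** * The map and its inverse *)

Section Setting.
Context {R : realType}.

(** [g] inverts the extension of [f] to the closures. Stating the bounds through a real [K] avoids
    subtraction of extended reals and treats [f] and [g] alike. *)
Record cqh_pair (M C : R) (E E' : normedModType R) (G : set E) (G' : set E')
    (f : E -> E') (g : E' -> E) : Prop := CqhPair {
  cqh_dim : dim_ge2 E;
  cqh_dim' : dim_ge2 E';
  cqh_dG : is_domain G;
  cqh_pG : G != [set: E];
  cqh_dG' : is_domain G';
  cqh_pG' : G' != [set: E'];
  cqh_fG : forall x, G x -> G' (f x);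
  cqh_gG : forall x, G' x -> G (g x);
  cqh_fb : forall x, boundary G x -> boundary G' (f x);
  cqh_gb : forall x, boundary G' x -> boundary G (g x);
  cqh_fK : forall x, closure G x -> g (f x) = x;
  cqh_gK : forall x, closure G' x -> f (g x) = x;
  cqh_cf : {within closure G, continuous f};
  cqh_cg : {within closure G', continuous g};
  cqh_kf : forall x y K, G x -> G y -> (qhyp G x y <= K%:E)%E ->
    (qhyp G' (f x) (f y) <= (M * K + C)%:E)%E;
  cqh_kg : forall x y K, G' x -> G' y -> (qhyp G' x y <= K%:E)%E ->
    (qhyp G (g x) (g y) <= (M * K + C)%:E)%E }.

Lemma cqh_pair_ex M C (E E' : normedModType R) (G : set E) (G' : set E') f :
  1 <= M -> dim_ge2 E -> dim_ge2 E' -> is_domain G -> G != [set: E] ->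
  is_domain G' -> G' != [set: E'] -> coarsely_qh M C G G' f ->
  homeomorphism_on (closure G) (closure G') f ->
  exists g, cqh_pair M C G G' f g.
Proof.
move=> M1 d2 d2' dG pG dG' pG' [[g1 [[fG g1G] _ g1K _ _]] k] [g [[fc gc] fK gK cf cg]].
have sG := @subset_closure _ G; have sG' := @subset_closure _ G'.
have fK' x : closure G x -> g (f x) = x by move=> ?; apply: fK; rewrite inE.
have gK' x : closure G' x -> f (g x) = x by move=> ?; apply: gK; rewrite inE.
(* The inverse of [f] over [G'] agrees with that of the extension. *)
have gG x : G' x -> G (g x).
  move=> Gx; have Gg := g1G x Gx.
  by have := fK' _ (sG _ Gg); rewrite g1K ?inE // => ->.
have M0 : 0 < M by exact: lt_le_trans ltr01 M1.
exists g; split => //.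
- move=> x [cx nGx]; split; first exact: fc.
  by move=> /gG; rewrite fK'.
- move=> x [cx nGx]; split; first exact: gc.
  by move=> /fG; rewrite gK'.
- move=> x y K Gx Gy xy; have [_ h] := k x y Gx Gy.
  apply: le_trans h _; rewrite EFinD EFinM leeD2r // lee_pmul2l //.
- move=> x y K Gx Gy xy; have [h _] := k (g x) (g y) (gG _ Gx) (gG _ Gy).
  rewrite !gK' in h; [|exact: sG'..].
  have := le_trans h xy; rewrite inver gt_eqF //.
  case: (qhyp G (g x) (g y)) => [q| |] //.
  + by rewrite -EFinB -EFinM !lee_fin ler_pdivrMr // lerBlDr mulrC.
  + by rewrite addye // gt0_mulye ?lte_fin ?invr_gt0.
  + by rewrite leNye.
Qed.
End Setting.
(** * Relative distances under the inverse map *)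

Section Crossing.
Context {R : realType} {E E' : normedModType R}.
Variables (M C : R) (G : set E) (G' : set E') (f : E -> E') (g : E' -> E).
Hypothesis fg : cqh_pair M C G G' f g.
Variables (o : E) (rho : R).
Hypothesis bo : forall p, boundary G p -> `|p - o| < rho.

(* The image of the exterior of a sphere around a ball containing the boundary;
   the part of E' beyond [G'] counts as inside. *)
Definition outside : set E' := [set x | G' x /\ rho < `|g x - o|].

Lemma open_outside : open outside.
Proof.
apply/open_normP => x [Gx gx]; have [_ oG' _] := cqh_dG' fg.
have [r r0 Hr] := (iffLR (open_normP _) oG') x Gx.
have e0 : 0 < `|g x - o| - rho by rewrite subr_gt0.
have [|r' r'0 Hr'] := (iffLR (within_continuousP _ _) (cqh_cg fg)) x _ _ e0.
  exact: subset_closure.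
exists (Num.min r r'); first by rewrite lt_min r0.
move=> y; rewrite lt_min => /andP[/Hr Gy xy]; split => //=.
have := Hr' y (subset_closure Gy) xy; have := ler_distD (g y) (g x) o; lra.
Qed.

Let closed_outside : closed [set x | closure G' x /\ rho <= `|g x - o|].
Proof.
move=> x /closure_normP H.
have cx : closure G' x.
  apply/closure_normP => r r0; have r2 : 0 < r / 2 by rewrite divr_gt0.
  have [y [/closure_normP /(_ _ r2)[z Gz yz] _] xy] := H _ r2; exists z => //.
  have := ler_distD y x z; lra.
split => //=; rewrite leNgt; apply/negP => gx.
have e0 : 0 < rho - `|g x - o| by rewrite subr_gt0.
have [r r0 Hr] := (iffLR (within_continuousP _ _) (cqh_cg fg)) x cx _ e0.
have [y [cy gy] xy] := H r r0.
have := Hr y cy xy; have := ler_distD (g x) (g y) o; rewrite (distrC (g y) (g x)); lra.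
Qed.

(** Otherwise the part of [B] in [outside] is open and closed in [B]: a limit of it in [B] lies in
    [G'], because [g] maps boundary points into the open ball, and it is not on the image of the
    sphere. *)
Lemma sphere_crossing (B : set E') x y : connected B -> B x -> B y ->
  G' x -> rho < `|g x - o| -> ~ (G' y /\ rho < `|g y - o|) ->
  exists2 z, B z & G' z /\ `|g z - o| = rho.
Proof.
move=> cB Bx By Gx gx ny; apply: contrapT => H; apply: ny.
suff BE : B `&` outside = B by move: By; rewrite -BE => -[].
apply: cB; first by exists x.
  by exists outside => //; exact: open_outside.
exists [set x | closure G' x /\ rho <= `|g x - o|]; first exact: closed_outside.
apply/seteqP; split=> z [Bz [Gz gz]]; split => //.
  by split; [exact: subset_closure|exact: ltW].
have G'z : G' z.
  apply: contrapT => nG; have := bo (cqh_gb fg (conj Gz nG)).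
  by rewrite ltNge gz.
split => //; rewrite lt_neqAle gz andbT; apply/negP => /eqP h.
by apply: H; exists z.
Qed.

End Crossing.
Lemma segpt_segpt (R : realType) (E : normedModType R) (x y : E) (s t : R) :
  segpt x (segpt x y s) t = segpt x y (t * s).
Proof. by rewrite /segpt addrAC subrr add0r scalerA. Qed.

Section FirstExit.
Context {R : realType} {E : normedModType R}.

Lemma segment_first_exit (Q : set E) x y : open Q -> ~ Q y ->
  exists t : R, [/\ 0 <= t, t <= 1, ~ Q (segpt x y t) &
    forall s, 0 <= s -> s < t -> Q (segpt x y s)].
Proof.
move=> oQ nQy.
pose S := [set t : R | 0 <= t <= 1 /\ ~ Q (segpt x y t)].
have S1 : S 1 by rewrite /S /= segpt1 ler01 lexx.
have Slb : lbound S 0 by move=> t [/andP[]].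
have hlb : has_lbound S by exists 0.
have i0 : 0 <= inf S by apply: lb_le_inf => //; exists 1.
have i1 : inf S <= 1 by exact: ge_inf.
have below s : 0 <= s -> s < inf S -> Q (segpt x y s).
  move=> s0 si; apply: contrapT => nQ.
  suff /(ge_inf hlb) : S s by rewrite leNgt si.
  by split => //; rewrite s0 (le_trans (ltW si)).
exists (inf S); split => // Qi.
have [r r0 Hr] := (iffLR (open_normP _) oQ) _ Qi.
pose e := r / (`|x - y| + 1).
have e0 : 0 < e by rewrite divr_gt0 // ltr_wpDl.
have [|s Ss se] := @inf_adherent _ S e e0; first by split; [exists 1|].
have is_ : inf S <= s by exact: ge_inf.
case: Ss => s01 ns; apply: ns; apply: Hr.
rewrite segpt_dist distrC ger0_norm ?subr_ge0 //.
apply: le_lt_trans (_ : (s - inf S) * (`|x - y| + 1) < _).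
  by rewrite ler_wpM2l ?subr_ge0 // lerDl.
by rewrite -ltr_pdivlMr ?ltr_wpDl // -/e; lra.
Qed.

End FirstExit.

(** * Domains whose boundary lies in a ball *)

Section Ring.
Context {R : realType}.
Implicit Types (M C t r : R).

Section SphereImage.
Context {E E' : normedModType R}.
Variables (M C : R) (G : set E) (G' : set E') (f : E -> E') (g : E' -> E).
Hypothesis fg : cqh_pair M C G G' f g.
Variables (o : E) (r : R) (x : E).
Hypotheses (r0 : 0 < r) (bo : forall p, boundary G p -> `|p - o| <= r).
Hypotheses (Gx : G x) (xo : r < `|x - o|).

(** The exterior of the ball is connected, misses the boundary and contains the point [x] of [G]. *)
Lemma ring_sub z : r < `|z - o| -> G z.
Proof.
move=> zo; have [B [cB Bx Bz HB]] := ball_complement_connected (cqh_dim fg) (ltW r0) xo zo.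
have [_ oG _] := cqh_dG fg.
apply: (connected_sub_open oG cB) => //; first by exists x.
by move=> p /HB; rewrite ltNge => /negP h /bo.
Qed.

Lemma ring_bdist z : 2 * r <= `|z - o| -> r <= bdist G z.
Proof.
move=> zo; apply: (le_bdist (cqh_dG fg) (cqh_pG fg)) => p /bo po.
have := ler_distD p z o; lra.
Qed.

Lemma ring_segment a e : `|a - o| = 16 * r -> `|e - o| = 16 * r ->
  (forall z, seg a e z -> 2 * r <= `|z - o|) ->
  `|f a - f e| <= expR (M * 32 + C + 1) * bdist G' (f a).
Proof.
move=> ao eo H; have r0' := r0.
have sG z : seg a e z -> G z by move=> /H h; apply: ring_sub; lra.
suff k : (qhyp G a e <= 32%:E)%E.
  have [] // := qhyp_dist (cqh_dG' fg) (cqh_pG' fg) (cqh_kf fg _ _ k).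
    exact/sG/seg_l.
  exact/sG/seg_r.
apply: le_trans (qhyp_le_segment sG r0 _) _; first by move=> z /H; exact: ring_bdist.
rewrite lee_fin ler_pdivrMr //.
have := ler_distD o a e; rewrite (distrC o e) ao eo; lra.
Qed.

Lemma ring_sphere_image (T := expR (M * 32 + C + 1)) a b :
  `|a - o| = 16 * r -> `|b - o| = 16 * r ->
  `|f a - f b| <= T * (2 + T) * bdist G' (f a).
Proof.
move=> ao bo'; have r16 : 0 < 16 * r by rewrite mulr_gt0.
(* The radius 16 r keeps the two segments at distance at least 2 r from [o], hence at least r from
   the boundary. *)
have r8 : 16 * r / 8 = 2 * r by field.
have [e eo He] := two_segments (cqh_dim fg) r16 ao bo'; rewrite r8 in He.
have h1 : `|f a - f e| <= T * bdist G' (f a).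
  by apply: ring_segment => // z ?; apply: He; left.
have h2 : `|f e - f b| <= T * bdist G' (f e).
  by apply: ring_segment => // z ?; apply: He; right.
have h3 := bdist_lip (cqh_dG' fg) (cqh_pG' fg) (f e) (f a).
have T0 : 0 < T by exact: expR_gt0.
have := ler_wpM2l (ltW T0) h3; have := ler_wpM2l (ltW T0) h1.
rewrite (distrC (f e)); have := ler_distD (f e) (f a) (f b); lra.
Qed.

End SphereImage.

(** The question is whether the boundary distance stays at least [d * bdist G' x] on the part of the
    segment from [x] to [y] outside the image of the ball of radius 16 r. If it does, [x] has
    bounded quasihyperbolic distance from the image of the sphere, and this is pulled back by [g].
    The other case is contradictory. *)
Lemma ring_dist M C t : 1 <= M -> 0 <= C -> 0 <= t -> exists2 lam : R, 0 < lam &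
  forall (E E' : normedModType R) (G : set E) (G' : set E') f g,
    cqh_pair M C G G' f g -> forall x y r, G' x -> G' y ->
    `|x - y| <= t * bdist G' x -> `|x - y| <= t * bdist G' y -> 0 < r ->
    (forall p, boundary G p -> `|p - g y| <= r) ->
    `|g x - g y| <= lam * r.
Proof.
move=> M1 C0 t0.
set T := expR (M * 32 + C + 1); have T0 : 0 < T by exact: expR_gt0.
set T2 := T * (2 + T); have T20 : 0 < T2 by rewrite mulr_gt0 // addr_gt0.
(* So small that for bdist a < d bdist x the ball of radius T2 bdist a around [a] contains neither
   [x] nor [y]; the factor 1 + t accounts for bdist x <= (1 + t) bdist y. *)
set d := (4 * (1 + T2) * (1 + t))^-1.
have t1 : 0 < 1 + t by rewrite ltr_pwDl.
have T21 : 0 < 1 + T2 by rewrite addr_gt0.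
have d0 : 0 < d by rewrite invr_gt0 !mulr_gt0.
have dE : d * (4 * (1 + T2) * (1 + t)) = 1 by rewrite mulVf // gt_eqF // -invr_gt0.
set Q := expR (M * (t / d) + C + 1); have Q0 : 0 < Q by exact: expR_gt0.
(* A point of the sphere of radius 16 r has boundary distance at most 17 r, so [qhyp_dist_r] puts
   [g x] within 17 Q^2 r of it. *)
exists (16 + 17 * (Q * Q)); first by rewrite addr_gt0 // !mulr_gt0.
move=> E E' G G' f g fg x y r Gx Gy tx ty r0 bo.
have [gxy|gxy] := leP `|g x - g y| (16 * r).
  by apply: le_trans gxy _; rewrite ler_pM2r // lerDl !mulr_ge0 // ltW.
have dG' := cqh_dG' fg; have pG' := cqh_pG' fg.
have dx0 : 0 < bdist G' x by exact: bdist_gt0.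
have dy0 : 0 < bdist G' y by exact: bdist_gt0.
have Ggx := cqh_gG fg Gx; have gxr : r < `|g x - g y| by lra.
have bo16 p : boundary G p -> `|p - g y| < 16 * r by move=> /bo; lra.
have cross := sphere_crossing fg bo16.
have Hfg z : G' z -> f (g z) = z by move=> ?; apply: (cqh_gK fg); exact: subset_closure.
have [H|] := pselect (forall q, seg x y q -> G' q -> 16 * r <= `|g q - g y| ->
  d * bdist G' x <= bdist G' q).
- (* The segment stays far from the boundary until it enters the image of the
     ball, so its quasihyperbolic length there is bounded. *)
  have nQy : ~ outside G' g (g y) (16 * r) y.
    by move=> [_]; rewrite subrr normr0; lra.
  have [u [u0 u1 nQ Qbelow]] := segment_first_exit x (open_outside fg (g y) (16 * r)) nQy.
  set q := segpt x y u in nQ.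
  have segq z : seg x q z -> exists2 v, 0 <= v <= u & z = segpt x y v.
    move=> [v /=]; rewrite in_itv /= => /andP[v0 v1] <-; exists (v * u).
      by rewrite mulr_ge0 // ler_piMl.
    by rewrite segpt_segpt.
  (* The crossing point is [q] itself, since the points before [q] lie strictly outside. *)
  have [z /segq[v /andP[v0 vu] zE] [Gz gz]] :=
    cross _ x q (@connected_seg _ _ x q) (seg_l x q) (seg_r x q) Gx gxy nQ.
  have vuE : v = u.
    apply/eqP; rewrite eq_le vu leNgt; apply/negP => /(Qbelow v v0)[_].
    by rewrite -zE gz ltxx.
  have zq : z = q by rewrite zE vuE.
  rewrite zq in Gz gz.
  have sG z' : seg x q z' -> G' z' /\ 16 * r <= `|g z' - g y|.
    move=> /segq[w /andP[w0]]; rewrite le_eqVlt => /predU1P[->|wu] ->.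
      by split; rewrite ?gz.
    by have [? /ltW] := Qbelow w w0 wu.
  have k : (qhyp G' x q <= (t / d)%:E)%E.
    apply: le_trans (qhyp_le_segment (d := d * bdist G' x) _ _ _) _.
    + by move=> z' /sG[].
    + exact: mulr_gt0.
    + move=> z' sz; have [Gz' gz'] := sG z' sz; apply: H => //.
      have [w /andP[w0 wu] ->] := segq z' sz.
      by exists w => //; rewrite /= in_itv /= w0 (le_trans wu).
    + rewrite lee_fin ler_pdivrMr ?mulr_gt0 // mulrA divfK ?gt_eqF //.
      apply: le_trans tx.
      have [] // : `|x - q| <= `|x - y| /\ `|q - y| <= `|x - y|.
      by apply: seg_dist; exists u => //; rewrite /= in_itv /= u0.
  have := qhyp_dist_r (cqh_dG fg) (cqh_pG fg) (cqh_kg fg Gx Gz k); rewrite -/Q => h.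
  have [p bp] := boundary_nonempty (cqh_dG fg) (cqh_pG fg).
  have h2 := bdist_le (g q) bp; have h3 := bo p bp.
  have h4 : bdist G (g q) <= 17 * r.
    have := ler_distD (g y) (g q) p; rewrite gz (distrC (g y) p); lra.
  have := ler_wpM2l (ltW (mulr_gt0 Q0 Q0)) h4.
  have := ler_distD (g q) (g x) (g y); rewrite gz; lra.
- move=> /existsNP[q /not_implyP[sq /not_implyP[Gq /not_implyP[gq /negP]]]].
  (* The segment comes so close to the boundary that the image of the sphere,
     which it then meets nearby, is too small to separate x from y. *)
  rewrite -ltNge => qd; exfalso.
  have [p bp qp] := bdist_lt_ex dG' pG' qd.
  have [a sa [Ga ga]] : exists2 a, seg q p a & G' a /\ `|g a - g y| = 16 * r.
    move: gq; rewrite le_eqVlt => /predU1P[gq|gq].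
      by exists q; [exact: seg_l|split].
    apply: (cross _ q p) => //; [exact: connected_seg|exact: seg_l|exact: seg_r|].
    by move=> [Gp _]; case: bp.
  have ad : bdist G' a < d * bdist G' x.
    apply: le_lt_trans (bdist_le a bp) _; apply: le_lt_trans qp.
    by have [] := seg_dist sa.
  have da0 : 0 < bdist G' a by exact: bdist_gt0.
  have near z : G' z -> `|g z - g y| = 16 * r -> `|z - a| <= T2 * bdist G' a.
    move=> Gz gz; have := ring_sphere_image fg r0 bo Ggx gxr ga gz.
    by rewrite !Hfg // distrC.
  have h1 := bdist_lip dG' pG' x a; have h2 := bdist_lip dG' pG' y a.
  have h3 := bdist_lip dG' pG' x y.
  have e1 z : d * (4 * (1 + T2)) * ((1 + t) * z) = z.
    have -> : d * (4 * (1 + T2)) * ((1 + t) * z) = d * (4 * (1 + T2) * (1 + t)) * z by ring.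
    by rewrite dE mul1r.
  have dT : 0 < d * (4 * (1 + T2)) by rewrite !mulr_gt0.
  have dxx : d * (4 * (1 + T2)) * bdist G' x <= bdist G' x.
    by rewrite -[leRHS]e1 ler_pM2l // ler_peMl ?lerDl // ltW.
  have dxy : d * (4 * (1 + T2)) * bdist G' x <= bdist G' y.
    rewrite -[leRHS]e1 ler_pM2l //; lra.
  have Tda := ler_wpM2l (ltW T20) (ltW ad).
  have dTx : 0 < T2 * (d * bdist G' x) := mulr_gt0 T20 (mulr_gt0 d0 dx0).
  have Ta0 : 0 <= T2 * bdist G' a by rewrite mulr_ge0 // ltW.
  have xa : T2 * bdist G' a < `|x - a| by lra.
  have ya : T2 * bdist G' a < `|y - a| by lra.
  have [B [cB Bx By HB]] := ball_complement_connected (cqh_dim' fg) Ta0 xa ya.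
  have [|z Bz [Gz gz]] := cross B x y cB Bx By Gx gxy.
    by move=> [_]; rewrite subrr normr0; lra.
  by have := HB z Bz; rewrite ltNge near.
Qed.
End Ring.
Section RelDist.
Context {R : realType}.

(** If |g x - g y| is large compared with bdist (g y), the cross ratio inequality confines the
    boundary of [G] to a ball around [g y] of radius comparable to bdist (g y), and [ring_dist]
    applies. *)
Let rel_dist_source_le (M C t : R) (eta : R -> R) :
  1 <= M -> 0 <= C -> homeo_gauge eta -> 0 <= t -> exists2 lam : R, 0 < lam &
  forall (E E' : normedModType R) (G : set E) (G' : set E') f g,
    cqh_pair M C G G' f g -> quasimobius_rel eta (closure G) (boundary G) f ->
    forall x y, G' x -> G' y -> `|x - y| <= t * bdist G' x -> `|x - y| <= t * bdist G' y ->
    `|g x - g y| <= lam * bdist G (g y).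
Proof.
move=> M1 C0 he t0.
have t1 : 0 < 1 + t by rewrite ltr_pwDl.
(* The distances from [x] and from [y] to a boundary point differ by a factor of at most 1 + t, and
   two boundary points are involved. *)
have [e e0 He] := quasimobius_source_bounded he (mulr_gt0 t1 t1).
have [l l0 Hl] := ring_dist M1 C0 t0.
pose s := 1 + e; have s1 : 1 <= s by rewrite lerDl ltW.
have s0 : 0 < s by exact: lt_le_trans s1.
exists (8 * s + l * (8 * s)); first by rewrite addr_gt0 ?mulr_gt0.
move=> E E' G G' f g fg qm x y Gx Gy tx ty.
have dG := cqh_dG fg; have pG := cqh_pG fg; have dG' := cqh_dG' fg; have pG' := cqh_pG' fg.
have Ggx := cqh_gG fg Gx; have Ggy := cqh_gG fg Gy.
set D := bdist G (g y); have D0 : 0 < D by exact: bdist_gt0.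
have D8 : 0 < 8 * s * D by rewrite !mulr_gt0.
have [X8|X8] := leP `|g x - g y| (8 * s * D).
  by apply: le_trans X8 _; rewrite ler_pM2r // lerDl !mulr_ge0 // ltW.
have inj : {in closure G &, injective f}.
  move=> a b; rewrite !inE => ca cb fab.
  by rewrite -(cqh_fK fg ca) fab (cqh_fK fg cb).
have Hf z : G' z -> f (g z) = z by move=> ?; apply: (cqh_gK fg); exact: subset_closure.
have [p bp yp] := bdist_near dG pG Ggy.
have sD : D <= s * D by rewrite ler_peMl // ltW.
suff bo w : boundary G w -> `|w - g y| <= 8 * s * D.
  apply: le_trans (Hl _ _ _ _ _ _ fg x y _ Gx Gy tx ty D8 bo) _.
  by rewrite mulrA ler_pM2r // lerDr !mulr_ge0 // ltW.
move=> bw; rewrite distrC.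
have [->|wp] := eqVneq w p; first by apply: le_trans yp _; rewrite -/D; lra.
have neq z q : G z -> boundary G q -> z != q.
  by move=> Gz [_ nq]; apply: contra_notN nq => /eqP <-.
have xy : g x != g y by rewrite -subr_eq0 -normr_gt0 (lt_trans D8).
have bb q : boundary G q -> 0 < `|x - f q| /\ bdist G' x <= `|x - f q| /\ bdist G' y <= `|y - f q|.
  move=> bq; have bq' := cqh_fb fg bq; have h1 := bdist_le x bq'; have h2 := bdist_le y bq'.
  by split; first exact: lt_le_trans (bdist_gt0 dG' pG' Gx) _.
have := He _ _ _ _ f qm inj (g x) (g y) p w (subset_closure Ggx) (subset_closure Ggy) bp bw.
have u : uniq [:: g x; p; w; g y].
  rewrite /= !inE !negb_or xy (neq _ _ Ggx bp) (neq _ _ Ggx bw) (eq_sym p w) wp.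
  by rewrite (eq_sym p) (neq _ _ Ggy bp) (eq_sym w) (neq _ _ Ggy bw).
move=> /(_ u); rewrite !Hf //.
have [_ [xp' yp']] := bb p bp; have [_ [xw' yw']] := bb w bw.
have h1 : `|x - f p| <= (1 + t) * `|y - f p|.
  have := ler_distD y x (f p); have := ler_wpM2l t0 yp'; lra.
have h2 : `|y - f w| <= (1 + t) * `|x - f w|.
  have := ler_distD x y (f w); have := ler_wpM2l t0 xw'; rewrite (distrC y x); lra.
have -> : (1 + t) * (1 + t) * (`|x - f w| * `|y - f p|) =
    ((1 + t) * `|y - f p|) * ((1 + t) * `|x - f w|) by ring.
move=> /(_ (ler_pM (normr_ge0 _) (normr_ge0 _) h1 h2)).
set X := `|g x - g y| in X8; set W := `|g y - w|.
have W0 : 0 <= W := normr_ge0 _.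
have hxp : X / 2 <= `|g x - p|.
  by have := ler_distD p (g x) (g y); rewrite (distrC p) -/X; move: yp; rewrite -/D; lra.
have hxw : `|g x - w| <= X + W by exact: ler_distD.
move=> h.
have h3 : X / 2 * W <= e * ((X + W) * (2 * D)).
  apply: le_trans (le_trans _ h) _; first exact: ler_wpM2r.
  by rewrite ler_pM2l // ler_pM.
have es : e <= s by rewrite lerDr.
have h4 : e * D * 8 <= X.
  by apply: le_trans (ltW X8); have := ler_wpM2r (ltW D0) es; lra.
have X0 : 0 < X by exact: lt_trans X8.
(* The term 2 e D W on the right of [h3] is at most X W / 4 by [h4] and is absorbed on the left. *)
have h5 : X * W <= X * (8 * e * D).
  have := ler_wpM2r W0 h4; lra.
rewrite ler_pM2l // in h5; apply: le_trans h5 _.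
by rewrite ler_pM2r // ler_pM2l.
Qed.

Lemma rel_dist_source (M C t : R) (eta : R -> R) :
  1 <= M -> 0 <= C -> homeo_gauge eta -> 0 <= t -> exists2 lam : R, 0 < lam &
  forall (E E' : normedModType R) (G : set E) (G' : set E') f g,
    cqh_pair M C G G' f g -> quasimobius_rel eta (closure G) (boundary G) f ->
    forall x y, G' x -> G' y -> rel_dist G' x y <= t -> rel_dist G (g x) (g y) <= lam.
Proof.
move=> M1 C0 he t0; have [l l0 H] := rel_dist_source_le M1 C0 he t0; exists l => //.
move=> E E' G G' f g fg qm x y Gx Gy.
rewrite (rel_distP t (cqh_dG' fg) (cqh_pG' fg)) // => /andP[tx ty].
have Ggx := cqh_gG fg Gx; have Ggy := cqh_gG fg Gy.
rewrite (rel_distP l (cqh_dG fg) (cqh_pG fg)) //.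
rewrite (H _ _ _ _ _ _ fg qm x y) // andbT (distrC (g x)).
by apply: (H _ _ _ _ _ _ fg qm y x) => //; rewrite distrC.
Qed.

End RelDist.

(** * Naturality of the image *)

Section Natural.
Context {R : realType}.

Lemma rel_dist_ge0 (E : normedModType R) (G : set E) x y :
  is_domain G -> G != [set: E] -> G x -> G y -> 0 <= rel_dist G x y.
Proof.
by move=> dG pG Gx Gy; rewrite /rel_dist divr_ge0 // le_min !ltW // bdist_gt0.
Qed.

(** The relative diameter is pulled back by [g], [psi] turns it into a bound on the quasihyperbolic
    diameter in [G], and [f] carries that to [G']. *)
Lemma natural_image (M C : R) (eta psi : R -> R) :
  1 <= M -> 0 <= C -> homeo_gauge eta -> increasing_gauge psi ->
  exists2 psi' : R -> R, increasing_gauge psi' &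
  forall (E E' : normedModType R) (G : set E) (G' : set E') f g,
    cqh_pair M C G G' f g -> quasimobius_rel eta (closure G) (boundary G) f ->
    natural_domain psi G -> natural_domain psi' G'.
Proof.
move=> M1 C0 he [psi0 psim].
have M0 : 0 < M by exact: lt_le_trans M1.
have [lam Hlam] := choice (fun n : nat =>
  let: ex_intro2 l l0 H := rel_dist_source M1 C0 he (ler0n R n) in ex_intro _ l (conj l0 H)).
(* The constant of [rel_dist_source] need not be monotone in t. Summing the positive [lam i] up to
   the integer truncn t + 1, which is at least t, gives an increasing bound. *)
pose Lam (t : R) := \sum_(i < (Num.truncn t).+2) lam i.
have Lam_mono s t : s <= t -> Lam s <= Lam t.
  move=> st; rewrite /Lam; have := le_truncn st => h.
  rewrite -!(big_mkord xpredT lam) (@big_cat_nat _ _ _ (Num.truncn s).+2 0 (Num.truncn t).+2) //=.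
  by rewrite lerDl sumr_ge0 // => i _; have [/ltW] := Hlam i.
have Lam0 t : 0 <= Lam t by apply: sumr_ge0 => i _; have [/ltW] := Hlam i.
have LamP t : exists2 n : nat, t <= n%:R & lam n <= Lam t.
  exists (Num.truncn t).+1; first exact/ltW/truncnS_gt.
  by rewrite /Lam big_ord_recr /= lerDr sumr_ge0 // => i _; have [/ltW] := Hlam i.
have in0 (t : R) : (t \in `[0, +oo[) = (0 <= t) by rewrite in_itv /= andbT.
exists (fun t => M * psi (Lam t) + C).
  split.
    by move=> t _; rewrite addr_ge0 // mulr_ge0 ?(ltW M0) // psi0 // in0.
  by move=> s t _ _ st; rewrite lerD2r ler_pM2l // psim ?in0 // Lam_mono.
move=> E E' G G' f g fg qm nG A [x0 Ax0] AG cA rA.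
have dG := cqh_dG fg; have pG := cqh_pG fg.
have dG' := cqh_dG' fg; have pG' := cqh_pG' fg.
have gG x : A x -> G (g x) by move=> /AG /(cqh_gG fg).
have rd_ub (F : normedModType R) (H B : set F) x y : B x -> B y ->
    ((rel_dist H x y)%:E <= rel_diam H B)%E.
  by move=> Bx By; apply: ereal_sup_ubound; exists x, y.
set t := fine (rel_diam G' A).
have tE : rel_diam G' A = t%:E.
  rewrite fineK // ge0_fin_numE //; apply: le_trans (rd_ub _ _ _ _ _ Ax0 Ax0).
  by rewrite lee_fin rel_dist_ge0 //; exact: AG.
have [n tn nL] := LamP t.
have rG : (rel_diam G (g @` A) <= (Lam t)%:E)%E.
  apply: ge_ereal_sup => _ [_ [_ [[x Ax <-] [y Ay <-] ->]]].
  rewrite lee_fin; apply: le_trans nL.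
  have [_ H] := Hlam n; apply: (H _ _ _ _ _ _ fg qm); [exact: AG|exact: AG|].
  by apply: le_trans tn; rewrite -lee_fin -tE; exact: rd_ub.
have rGge0 : (0 <= rel_diam G (g @` A))%E.
  have Agx : (g @` A) (g x0) by exists x0.
  apply: le_trans (rd_ub _ _ _ _ _ Agx Agx).
  by rewrite lee_fin rel_dist_ge0 //; exact: gG.
have kA : (qhyp_diam G (g @` A) <= (psi (Lam t))%:E)%E.
  apply: (@le_trans _ _ (psi (fine (rel_diam G (g @` A))))%:E).
    apply: nG.
    - by exists (g x0); exists x0.
    - by move=> _ [x /gG Gx <-].
    - apply: connected_continuous_connected => //.
      by apply: continuous_subspaceW (cqh_cg fg) => x /AG /subset_closure.
    - exact: le_lt_trans rG (ltry _).
  rewrite lee_fin psim ?in0 ?fine_ge0 //.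
  by rewrite -lee_fin fineK // ge0_fin_numE // (le_lt_trans rG) // ltry.
apply: ge_ereal_sup => _ [x [y [Ax Ay ->]]].
have Hf z : A z -> f (g z) = z.
  by move=> /AG Gz; apply: (cqh_gK fg); exact: subset_closure.
rewrite -[x in qhyp _ x]Hf // -[y in qhyp _ _ y]Hf //.
apply: (cqh_kf fg); [exact: gG|exact: gG|].
apply: le_trans kA; apply: ereal_sup_ubound.
by exists (g x), (g y).
Qed.
End Natural.
(** * Images of uniform arcs *)

Section Cone.
Context {R : realType}.

(** The relative distance of the ends is pulled back to [G], where [uniform_subcurve_qhyp] applies,
    and the resulting bound is carried to [G']. *)
Lemma uniform_image_qhyp (M C c t : R) (eta : R -> R) :
  1 <= M -> 0 <= C -> 1 <= c -> homeo_gauge eta -> 0 <= t -> exists K : R,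
  forall (E E' : normedModType R) (G : set E) (G' : set E') f g,
    cqh_pair M C G G' f g -> quasimobius_rel eta (closure G) (boundary G) f ->
    forall h a b L, uniform_curve c G h a b L ->
    forall s q u, a <= s -> s <= q -> q <= u -> u <= b ->
    rel_dist G' (f (h s)) (f (h u)) <= t ->
    (qhyp G' (f (h s)) (f (h q)) <= K%:E)%E.
Proof.
move=> M1 C0 c1 he t0; have [l l0 H] := rel_dist_source M1 C0 he t0.
exists (M * (16 * c ^+ 3 * (1 + l)) + C) => E E' G G' f g fg qm h a b L ug s q u as_ sq qu ub hr.
have [[ab ch Gh] _ _ _ _] := ug.
have Gs : G (h s) by apply: Gh; rewrite in_itv /=; lra.
have Gq : G (h q) by apply: Gh; rewrite in_itv /=; lra.
have Gu : G (h u) by apply: Gh; rewrite in_itv /=; lra.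
have := H _ _ _ _ _ _ fg qm _ _ (cqh_fG fg Gs) (cqh_fG fg Gu) hr.
rewrite !(cqh_fK fg) ?(rel_distP l (cqh_dG fg) (cqh_pG fg)) //; try exact: subset_closure.
move=> /andP[h1 h2]; apply: (cqh_kf fg) => //.
exact: (uniform_subcurve_qhyp c1 (cqh_dG fg) (cqh_pG fg) ug as_ sq qu ub).
Qed.

(** P, U, V, Wz are the distances from a point z to p, u, v, w; Wu and Wv are those from u and v to
    w, and uv, up, vp those between the points named. The two cross ratio bounds put w so close to
    both u and v that uv <= Wu + Wv fails. *)
Lemma same_side_contradiction (c e P U V Wz Wu Wv uv up vp : R) :
  1 <= c -> e * (8 * c * (1 + c)) = 1 -> 0 < P -> 0 < U -> 0 <= V -> 0 <= Wz ->
  U <= c * P -> U <= c * uv -> V <= c * uv -> up <= P + U -> vp <= P + V ->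
  Wz <= U + Wu -> uv <= Wu + Wv ->
  P * Wu <= e * (Wz * up) -> P * Wv <= e * (Wz * vp) -> False.
Proof.
move=> c1 ee P0 U0 V0 Wz0 UP Uuv Vuv hup hvp hWz huv h1 h2.
have c0 : 0 < c by lra.
have e0 : 0 < e.
  by rewrite -(pmulr_lgt0 _ (_ : 0 < 8 * c * (1 + c))) ?ee // !mulr_gt0 //; lra.
have Wu8 : 8 * c * Wu <= Wz.
  have : P * Wu <= e * (1 + c) * Wz * P.
    apply: le_trans h1 _; have -> : e * (1 + c) * Wz * P = e * (Wz * ((1 + c) * P)) by ring.
    rewrite ler_pM2l //; apply: ler_wpM2l => //; lra.
  rewrite mulrC ler_pM2r // => h.
  have <- : 8 * c * (e * (1 + c) * Wz) = Wz.
    by transitivity (e * (8 * c * (1 + c)) * Wz); [ring|rewrite ee mul1r].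
  by rewrite ler_pM2l // mulr_gt0.
have uv0 : 0 < uv by rewrite -(pmulr_rgt0 _ c0) (lt_le_trans U0).
have Wu8' : 8 * Wu <= Wz.
  have [Wu0|/ltW Wu0] := leP 0 Wu; last by lra.
  by apply: le_trans Wu8; rewrite ler_wpM2r // ler_peMr.
have Wz2 : Wz <= 2 * U by lra.
have Wv2 : Wv <= e * (2 * U + 2 * c * V).
  have : P * Wv <= e * (2 * U + 2 * c * V) * P.
    apply: le_trans h2 _; rewrite -mulrA ler_pM2l //.
    apply: le_trans (_ : Wz * (P + V) <= _); first exact: ler_wpM2l.
    have h3 : Wz * V <= 2 * (c * P) * V by apply: ler_wpM2r => //; lra.
    have := ler_wpM2r (ltW P0) Wz2; lra.
  by rewrite mulrC ler_pM2r.
have Wv8 : 8 * c * Wv <= U + 2 * V.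
  have <- : 8 * c * (e * ((1 + c) * (U + 2 * V))) = U + 2 * V.
    by transitivity (e * (8 * c * (1 + c)) * (U + 2 * V)); [ring|rewrite ee mul1r].
  rewrite ler_pM2l ?mulr_gt0 //; apply: le_trans Wv2 _; rewrite ler_pM2l //.
  have := ler_wpM2r (ltW U0) c1; lra.
have := ler_wpM2l (ltW c0) huv; have := mulr_gt0 c0 uv0; lra.
Qed.
End Cone.
Section ConeCondition.
Context {R : realType}.

(** Let p' be a boundary point near f z. A boundary point w' farther away than claimed would make
    the cross ratios of p', w' with f z, f u and with f z, f v small, hence also those of the
    preimages, against [same_side_contradiction]. *)
Lemma boundary_confined (c : R) (eta : R -> R) : 1 <= c -> homeo_gauge eta ->
  exists2 K : R, 4 <= K &
  forall (M C : R) (E E' : normedModType R) (G : set E) (G' : set E') f g,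
    cqh_pair M C G G' f g -> quasimobius_rel eta (closure G) (boundary G) f ->
    forall u v z, G u -> G v -> G z ->
    `|z - u| <= c * `|u - v| -> `|z - v| <= c * `|u - v| -> `|z - u| <= c * bdist G z ->
    K * bdist G' (f z) <= `|f z - f u| -> K * bdist G' (f z) <= `|f z - f v| ->
    forall w, boundary G' w -> `|f z - w| <= K * bdist G' (f z).
Proof.
move=> c1 he; have c0 : 0 < c by lra.
pose e := (8 * c * (1 + c))^-1.
have c10 : 0 < 1 + c by lra.
have e0 : 0 < e by rewrite invr_gt0 !mulr_gt0.
have ee : e * (8 * c * (1 + c)) = 1 by rewrite mulVf // gt_eqF // !mulr_gt0.
have [k k0 Hk] := quasimobius_source_small he e0.
(* The term 8 / k makes the image cross ratios at most k. The 4 keeps p', which is within 2 D of f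
   z, away from w', f u and f v. *)
pose K := 4 + 8 / k; have K4 : 4 <= K by rewrite lerDl divr_ge0 // ltW.
have K0 : 0 < K by lra.
have kK : 8 <= k * K.
  by rewrite /K mulrDr mulrCA divff ?gt_eqF // mulr1 lerDr mulr_ge0 // ltW.
exists K => // M C E E' G G' f g fg qm u v z Gu Gv Gz zu zv zuz fzu fzv w' bw'.
have dG := cqh_dG fg; have pG := cqh_pG fg; have dG' := cqh_dG' fg; have pG' := cqh_pG' fg.
have Gfz := cqh_fG fg Gz; set D := bdist G' (f z) in fzu fzv *.
have D0 : 0 < D by exact: bdist_gt0.
rewrite leNgt; apply/negP => fzw.
have [p' bp' zp'] := bdist_near dG' pG' Gfz; rewrite -/D in zp'.
have fgK q : boundary G' q -> f (g q) = q by move=> [cq _]; exact: (cqh_gK fg).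
have bp := cqh_gb fg bp'; have bw := cqh_gb fg bw'.
have wp : g p' != g w'.
  apply: contraTneq fzw => h; rewrite -leNgt -(fgK _ bw') -h fgK //.
  apply: le_trans zp' _; rewrite ler_pM2r //; lra.
have inj : {in closure G &, injective f}.
  move=> a b; rewrite !inE => ca cb fab.
  by rewrite -(cqh_fK fg ca) fab (cqh_fK fg cb).
have neq x q : G x -> boundary G q -> x != q.
  by move=> Gx [_ nq]; apply: contra_notN nq => /eqP <-.
have KD : 4 * D <= K * D by rewrite ler_pM2r.
have side y : G y -> K * D <= `|f z - f y| ->
    `|z - g p'| * `|y - g w'| <= e * (`|z - g w'| * `|y - g p'|).
  move=> Gy fzy; apply: (Hk _ _ _ _ _ qm inj) => //; try exact: subset_closure.
    have zy : z != y.
      by apply: contraTneq fzy => ->; rewrite subrr normr0 -ltNge mulr_gt0.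
    rewrite /= !inE !negb_or zy !(neq z) //= wp /=.
    by rewrite !(eq_sym (g _)) !(neq y).
  rewrite !fgK //.
  set A := `|f z - f y| in fzy; set B := `|f z - w'| in fzw.
  have h1 : `|f y - w'| <= A + B.
    by rewrite /A (distrC (f z)); exact: ler_distD.
  have h2 : A / 2 <= `|f y - p'|.
    have := ler_distD p' (f z) (f y); rewrite (distrC p') -/A; lra.
  have A0 : 0 < A by lra.
  have B0 : 0 < B by lra.
  apply: le_trans (_ : 2 * D * (A + B) <= _); first exact: ler_pM.
  apply: le_trans (_ : k * (B * (A / 2)) <= _); last by rewrite !ler_pM2l.
  have hA : 8 * D <= k * A.
    apply: le_trans (_ : k * (K * D) <= _); last by rewrite ler_pM2l.
    by rewrite mulrA ler_pM2r.
  have hB : 8 * D <= k * B.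
    apply: le_trans (_ : k * (K * D) <= _); last by rewrite ler_pM2l // ltW.
    by rewrite mulrA ler_pM2r.
  have := ler_wpM2r (ltW B0) hA; have := ler_wpM2r (ltW A0) hB; lra.
have P0 : 0 < `|z - g p'| by rewrite normr_gt0 subr_eq0 neq.
have U0 : 0 < `|z - u|.
  rewrite normr_gt0 subr_eq0; apply: contraTneq fzu => ->.
  by rewrite subrr normr0 -ltNge mulr_gt0.
apply: (@same_side_contradiction _ c e `|z - g p'| `|z - u| `|z - v| `|z - g w'|
  `|u - g w'| `|v - g w'| `|u - v| `|u - g p'| `|v - g p'|) => //.
- apply: le_trans zuz _; rewrite ler_pM2l //; exact: bdist_le.
- by rewrite [leRHS]addrC (distrC z u); exact: ler_distD.
- by rewrite [leRHS]addrC (distrC z v); exact: ler_distD.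
- exact: ler_distD.
- by rewrite (distrC v); exact: ler_distD.
- exact: side.
- exact: side.
Qed.

Lemma continuous_within_dist (E : normedModType R) (A : set R) (h : R -> E) z :
  {within A, continuous h} -> {within A, continuous (fun t => `|h t - z|)}.
Proof.
move=> /within_continuousP ch; apply/within_continuousP => t At e e0.
have [r r0 Hr] := ch t At e e0; exists r => // s As st.
apply: le_lt_trans (Hr s As st); apply: le_trans (ler_dist_dist _ _) _.
by rewrite opprB addrA subrK.
Qed.

Lemma continuous_within_comp (E E' : normedModType R) (A : set R) (B : set E)
    (h : R -> E) (f : E -> E') : (forall t, A t -> B (h t)) ->
  {within A, continuous h} -> {within B, continuous f} -> {within A, continuous (f \o h)}.
Proof.
move=> AB /within_continuousP ch /within_continuousP cf.
apply/within_continuousP => t At e e0.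
have [r r0 Hr] := cf _ (AB _ At) e e0; have [r' r'0 Hr'] := ch t At r r0.
by exists r' => // s As st; apply: Hr; [exact: AB|exact: Hr'].
Qed.

Lemma cone_condition (M C c : R) (eta : R -> R) :
  1 <= M -> 0 <= C -> 1 <= c -> homeo_gauge eta -> exists2 K : R, 1 <= K &
  forall (E E' : normedModType R) (G : set E) (G' : set E') f g,
    cqh_pair M C G G' f g -> quasimobius_rel eta (closure G) (boundary G) f ->
    forall h a b L, uniform_curve c G h a b L -> forall q, a <= q -> q <= b ->
    `|f (h q) - f (h a)| <= K * bdist G' (f (h q)) \/
    `|f (h q) - f (h b)| <= K * bdist G' (f (h q)).
Proof.
move=> M1 C0 c1 he.
have [K K4 HK] := boundary_confined c1 he.
(* With D = bdist (f (h q)), two crossing points on the sphere of radius N D around f (h q) will be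
   at most 2 N D apart and at distance at least N D / 2 from the boundary, so their relative
   distance is at most 4. *)
have [K1 HK1] := uniform_image_qhyp M1 C0 c1 he (ler0n R 4).
set Q := expR (K1 + 1); have Q0 : 0 < Q by exact: expR_gt0.
(* N >= 2 K leaves half the radius between the sphere and the boundary, and N > Q^2 contradicts
   [qhyp_dist_r]. *)
pose N := 2 * K + Q * Q + 1.
have QQ : 0 < Q * Q by rewrite mulr_gt0.
have N0 : 0 < N by rewrite /N; lra.
exists N; first by rewrite /N; lra.
move=> E E' G G' f g fg qm h a b L ug q aq qb.
have [[ab ch Gh] La LE Lb Lc] := ug.
have dG' := cqh_dG' fg; have pG' := cqh_pG' fg.
have Gt t : a <= t -> t <= b -> G (h t) by move=> ? ?; apply: Gh; rewrite in_itv /=; lra.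
have Gz := Gt q aq qb; have Ga := Gt a (lexx a) ab; have Gb := Gt b ab (lexx b).
have Gfz := cqh_fG fg Gz; set D := bdist G' (f (h q)).
have D0 : 0 < D by exact: bdist_gt0.
have [?|ha] := leP `|f (h q) - f (h a)| (N * D); [by left|right].
rewrite leNgt; apply/negP => hb.
have KN : K * D <= N * D by rewrite ler_pM2r // /N; lra.
have conf w : boundary G' w -> `|f (h q) - w| <= K * D.
  have za := arclength_dist LE (lexx a) aq qb.
  have zb := arclength_dist LE aq qb (lexx b).
  have Lqb := arclength_mono LE aq qb (lexx b).
  have Lq0 := arclength_mono LE (lexx a) aq qb; rewrite La in Lq0.
  rewrite La subr0 in za; rewrite distrC in zb.
  have [hz|hz] := Lc q aq qb.
    by apply: (HK _ _ _ _ _ _ _ _ fg qm (h a) (h b)) => //; rewrite -/D; lra.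
  by apply: (HK _ _ _ _ _ _ _ _ fg qm (h b) (h a)) => //; rewrite ?(distrC (h b) (h a)) -/D; lra.
have cfh : {within `[a, b], continuous (fun t => `|f (h t) - f (h q)|)}.
  apply: (@continuous_within_dist _ _ (f \o h)).
  apply: (continuous_within_comp (B := closure G)) ch (cqh_cf fg).
  by move=> t /Gh; exact: subset_closure.
have sub s t : a <= s -> t <= b -> {within `[s, t], continuous (fun t => `|f (h t) - f (h q)|)}.
  move=> as_ tb; apply: continuous_subspaceW cfh => u; rewrite /= !in_itv /=; lra.
have ND : 0 < N * D by rewrite mulr_gt0.
have [||t1 t1I t1E] := @IVT _ (fun t => `|f (h t) - f (h q)|) a q (N * D) aq.
- exact: sub.
- by rewrite subrr normr0 ge_min le_max (ltW ND) orbT /= distrC (ltW ha).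
have [||t2 t2I t2E] := @IVT _ (fun t => `|f (h t) - f (h q)|) q b (N * D) qb.
- exact: sub.
- by rewrite subrr normr0 ge_min le_max (ltW ND) /= (distrC _ (f (h q))) (ltW hb) orbT.
move: t1I t2I; rewrite !in_itv /= => /andP[at1 t1q] /andP[qt2 t2b].
have Gf1 := cqh_fG fg (Gt t1 at1 (le_trans t1q qb)).
have Gf2 := cqh_fG fg (Gt t2 (le_trans aq qt2) t2b).
have NK : 2 * (K * D) <= N * D by rewrite mulrA ler_pM2r // /N; lra.
have far t : `|f (h t) - f (h q)| = N * D -> N * D / 2 <= bdist G' (f (h t)).
  move=> tE; apply: (le_bdist dG' pG') => p /conf hp.
  have := ler_distD p (f (h t)) (f (h q)); rewrite tE (distrC p); lra.
have k : (qhyp G' (f (h t1)) (f (h q)) <= K1%:E)%E.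
  apply: (HK1 _ _ _ _ _ _ fg qm _ _ _ _ ug t1 q t2) => //.
  rewrite rel_distP //; have := far _ t1E; have := far _ t2E.
  have := ler_distD (f (h q)) (f (h t1)) (f (h t2)).
  rewrite t1E (distrC (f (h q))) t2E => ? ? ?; apply/andP; split; lra.
have := qhyp_dist_r dG' pG' k; rewrite t1E -/Q ler_pM2r // /N; lra.
Qed.

End ConeCondition.

(** * Chains in the image domain *)

Section ChainLists.
Context {R : realType} {E : normedModType R}.
Implicit Types (G : set E) (x y z : E) (l s : seq E).

Definition list_length s : R := if s is x :: l then chain_length x l else 0.

Lemma fine_step_refl G x : 0 <= bdist G x -> fine_step G x x.
Proof. by move=> d0; rewrite /fine_step subrr normr0 divr_ge0. Qed.

Lemma fine_stepC G x y : fine_step G x y = fine_step G y x.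
Proof. by rewrite /fine_step distrC andbC. Qed.

Lemma chain_length_prefix x l s : chain_length x l <= chain_length x (l ++ s).
Proof. by rewrite chain_length_cat lerDl chain_length_ge0. Qed.

Lemma list_length_rev s : list_length (rev s) = list_length s.
Proof.
case: s => //= x l; elim: l x => [|y l IH] x //=.
rewrite -IH !rev_cons; case: (rev l) => [|w r] /=; first by rewrite distrC addrC.
by rewrite -(cats1 _ x) chain_length_cat last_rcons /= addr0 addrC distrC.
Qed.

Lemma cat_eq_split (T : Type) (A B s1 s2 : seq T) (z : T) : A ++ B = s1 ++ z :: s2 ->
  (exists t, A = s1 ++ z :: t) \/ (exists2 t, s1 = A ++ t & B = t ++ z :: s2).
Proof.
elim: A s1 => [|u A IH] [|v s1] /=.
- by right; exists [::].
- by move=> ->; right; exists (v :: s1).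
- by move=> [<- _]; left; exists A.
- by move=> [<- /IH[[t ->]|[t -> ->]]]; [left; exists t|right; exists t].
Qed.

(** One half of the cone condition of a uniform arc, for the vertices of a chain. *)
Definition left_cone_chain G (N : R) s : Prop :=
  forall s1 z s2, s = s1 ++ z :: s2 -> list_length (rcons s1 z) <= N * bdist G z.

Lemma left_cone_cat G N x l l' : left_cone_chain G N (x :: l) ->
  (forall z, z \in l' -> chain_length x (l ++ l') <= N * bdist G z) ->
  left_cone_chain G N (x :: l ++ l').
Proof.
move=> H H' s1 z s2; rewrite -cat_cons => e0.
have [[t e]|[t -> lE]] := cat_eq_split e0; first exact: H e.
rewrite rcons_cat /=; apply: le_trans (H' z _); last by rewrite lE mem_cat mem_head orbT.
by rewrite lE -cat_rcons catA chain_length_prefix.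
Qed.

End ChainLists.

Section HalfChain.
Context {R : realType} {E : normedModType R}.
Variables (G : set E) (h : R -> E) (a b N K : R).
Hypotheses (dG : is_domain G) (pG : G != [set: E]) (ab : a <= b) (N1 : 1 <= N) (K0 : 0 <= K).
Hypotheses (Gh : forall t, t \in `[a, b] -> G (h t)).
Hypothesis ch : {within `[a, b], continuous h}.
Hypothesis cone : forall t, t \in `[a, b] -> `|h t - h a| <= N * bdist G (h t).
Hypothesis short : forall x y, G x -> G y -> rel_dist G x y <= 4 * N -> (qhyp G x y <= K%:E)%E.

Let Q := expR (K + 1).

(** Induction on the number of halvings that bring the boundary distance at [t] down to its minimum
    on the path. From [t] one goes back to a [u] where it is half as large, and a chain from [h u]
    to [h t] is added to the one obtained for [u]. *)
Lemma half_chain : exists l, [/\ path (fine_step G) (h a) l, last (h a) l = h b,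
  chain_length (h a) l <= Q ^+ 2 * bdist G (h b), forall z, z \in h a :: l -> G z &
  left_cone_chain G (2 * Q ^+ 3) (h a :: l)].
Proof.
have Q0 : 0 < Q by exact: expR_gt0.
have Q1 : 1 <= Q by rewrite -expR0 ler_expR addr_ge0.
have N1' := N1.
have cd : {within `[a, b], continuous (fun t => bdist G (h t))}.
  apply/within_continuousP => t At e e0.
  have [r r0 Hr] := (iffLR (within_continuousP _ _) ch) t At e e0; exists r => // s As st.
  by apply: le_lt_trans (Hr s As st); exact: bdist_dist.
have [m mI Hm] := EVT_min ab cd.
have dpos t : t \in `[a, b] -> 0 < bdist G (h t) by move=> /Gh; exact: bdist_gt0.
set d := bdist G (h m) in Hm; have d0 : 0 < d by exact: dpos.
have aI : a \in `[a, b] by rewrite in_itv /= lexx.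
have bI : b \in `[a, b] by rewrite in_itv /= ab lexx.
suff H n t : t \in `[a, b] -> bdist G (h t) <= 2 ^+ n * d ->
    exists l, [/\ path (fine_step G) (h a) l, last (h a) l = h t,
      chain_length (h a) l <= Q ^+ 2 * bdist G (h t), forall z, z \in h a :: l -> G z &
      left_cone_chain G (2 * Q ^+ 3) (h a :: l)].
  apply: (@H (Num.truncn (bdist G (h b) / d)).+1 b bI).
  rewrite -ler_pdivrMr //; apply: le_trans (ltW (truncnS_gt _)) _.
  by rewrite -natrX ler_nat ltnW // ltn_expl.
have Q2 : Q <= Q ^+ 2 by rewrite expr2 ler_peMl // ltW.
have Q3 : Q ^+ 2 <= 2 * Q ^+ 3.
  have : Q ^+ 2 <= Q ^+ 3 by rewrite [leRHS]exprS ler_peMl // exprn_ge0 // ltW.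
  have : 0 <= Q ^+ 3 by rewrite exprn_ge0 // ltW.
  lra.
have piece x y : G x -> G y -> rel_dist G x y <= 4 * N ->
    exists l, [/\ path (fine_step G) x l, last x l = y, chain_length x l <= Q * bdist G x &
      forall z, z \in x :: l -> G z /\ bdist G x <= Q * bdist G z].
  by move=> Gx Gy xy; apply: qhyp_chain => //; exact: short.
(* No halving is possible or needed here, and a single chain from [h a] suffices. *)
have direct u : u \in `[a, b] -> bdist G (h u) / 2 <= bdist G (h a) ->
    exists l, [/\ path (fine_step G) (h a) l, last (h a) l = h u,
      chain_length (h a) l <= Q ^+ 2 * bdist G (h u), forall z, z \in h a :: l -> G z &
      left_cone_chain G (2 * Q ^+ 3) (h a :: l)].
  move=> uI ua; have [|l [l1 l2 l3 l4]] := piece (h a) (h u) (Gh aI) (Gh uI).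
    rewrite rel_distP //; try exact: Gh.
    have cu := cone uI; rewrite distrC.
    have h1 : N * (bdist G (h u) / 2) <= N * bdist G (h a) by rewrite ler_pM2l //; lra.
    have := mulr_ge0 (le_trans ler01 N1) (ltW (dpos u uI)).
    by move=> h2; apply/andP; split; lra.
  have lz z : z \in h a :: l -> chain_length (h a) l <= Q ^+ 2 * bdist G z.
    by move=> /l4[_ h4]; apply: le_trans l3 _; rewrite expr2 -mulrA ler_pM2l.
  exists l; split => //.
  - by apply: lz; rewrite -l2 mem_last.
  - by move=> z /l4[].
  - move=> s1 z s2 lE; have zl : z \in h a :: l by rewrite lE mem_cat mem_head orbT.
    have [Gz _] := l4 z zl.
    apply: (@le_trans _ _ (list_length (h a :: l))).
      rewrite lE -cat_rcons; case: (s1) lE => [|w r] [<- _] /=; last exact: chain_length_prefix.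
      by rewrite chain_length_ge0.
    apply: le_trans (lz z zl) _; rewrite ler_wpM2r //; exact/ltW/bdist_gt0.
elim: n t => [|n IH] t tI tn; have dt := dpos t tI;
    have [da|da] := leP (bdist G (h t) / 2) (bdist G (h a)); try exact: direct.
  by have := Hm a aI; move: tn; rewrite expr0 mul1r; lra.
have [at_ tb] : a <= t /\ t <= b by move: tI; rewrite in_itv /= => /andP[].
have [||u uI uE] := @IVT _ (fun t => bdist G (h t)) a t (bdist G (h t) / 2) at_.
- by apply: continuous_subspaceW cd => s; rewrite /= !in_itv /=; lra.
- rewrite ge_min le_max (ltW da) /=; apply/orP; right; lra.
have {}uI : u \in `[a, b] by move: uI; rewrite !in_itv /=; lra.
have [|l [l1 l2 l3 l4 l5]] := IH u uI.
  by rewrite uE ler_pdivrMr // mulrAC -exprSr.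
have [|l' [k1 k2 k3 k4]] := piece (h u) (h t) (Gh uI) (Gh tI).
  rewrite rel_distP //; try exact: Gh.
  have cu := cone uI; have ct := cone tI.
  have := ler_distD (h a) (h u) (h t); rewrite (distrC (h a) (h t)) uE in cu *.
  have := mulr_ge0 (le_trans ler01 N1) (ltW dt).
  by move=> h1 h2; apply/andP; split; lra.
(* The old chain contributes Q^2 / 2 and the new one Q / 2, so the constant does not grow. *)
have tot : chain_length (h a) (l ++ l') <= Q ^+ 2 * bdist G (h t).
  rewrite chain_length_cat l2; rewrite uE in l3 k3.
  have := ler_wpM2r (ltW dt) Q2; lra.
exists (l ++ l'); split => //.
- by rewrite cat_path l1 l2.
- by rewrite last_cat l2.
- move=> z; rewrite -cat_cons mem_cat => /orP[/l4//|zl'].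
  by have [] := k4 z; rewrite ?in_cons ?zl' ?orbT.
(* At a new vertex the boundary distance is at least bdist (h u) / Q = bdist (h t) / (2 Q), whence
   the constant 2 Q^3. *)
- apply: left_cone_cat => // z zl'.
  have [|Gz hz] := k4 z; first by rewrite in_cons zl' orbT.
  apply: le_trans tot _; rewrite uE in hz.
  have := ler_wpM2l (exprn_ge0 2 (ltW Q0)) hz.
  rewrite [X in _ <= X -> _]mulrA -exprSr; lra.
Qed.
End HalfChain.
Section TwoSidedChain.
Context {R : realType}.

Lemma first_time (phi : R -> R) a b v : a <= b -> {within `[a, b], continuous phi} ->
  phi a <= v -> v <= phi b ->
  exists t, [/\ a <= t, t <= b, phi t = v & forall s, a <= s -> s <= t -> phi s <= v].
Proof.
move=> ab cp va vb; pose S := [set t | a <= t <= b /\ v <= phi t].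
have Sb : S b by rewrite /S /= ab lexx.
have hlb : has_lbound S by exists a => t [/andP[]].
have ai : a <= inf S by apply: lb_le_inf; [exists b|move=> t [/andP[]]].
have ib : inf S <= b by exact: ge_inf.
have below s : a <= s -> s < inf S -> phi s < v.
  move=> as_ si; rewrite ltNge; apply/negP => h.
  suff /(ge_inf hlb) : S s by rewrite leNgt si.
  by split => //; rewrite as_ ltW // (lt_le_trans si).
have iI : inf S \in `[a, b] by rewrite in_itv /= ai.
have vi : v <= phi (inf S).
  rewrite leNgt; apply/negP => h; have e0 : 0 < v - phi (inf S) by rewrite subr_gt0.
  have [r r0 Hr] := (iffLR (within_continuousP _ _) cp) _ iI _ e0.
  have hinf : has_inf S by split; [exists b|].
  have [s Ss sr] := inf_adherent r0 hinf.
  have is_ : inf S <= s by exact: ge_inf.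
  case: Ss => /andP[as_ sb] vs.
  have : `|phi (inf S) - phi s| < v - phi (inf S).
    apply: Hr; first by rewrite /= in_itv /= as_.
    by rewrite distrC ger0_norm ?subr_ge0 //; lra.
  by rewrite ltr_norml; lra.
have [||t tI tE] := @IVT R phi a (inf S) v ai.
  by apply: continuous_subspaceW cp => s; rewrite /= !in_itv /=; lra.
  by rewrite ge_min le_max va vi orbT.
move: tI; rewrite in_itv /= => /andP[at_ ti]; exists t; split => //.
  exact: le_trans ib.
move=> s as_ st; have [->|sn] := eqVneq s t; first by rewrite tE.
by apply/ltW/below => //; apply: lt_le_trans ti; rewrite lt_neqAle sn.
Qed.

Section OneSpace.
Context {E : normedModType R}.
Implicit Types (G : set E) (k : R -> E) (N K : R).

(** Until the distance from [k a] first reaches half of |k a - k b|, the path is at least as far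
    from [k b] as from [k a], so either alternative of the cone condition gives the one for
    [k a]. *)
Lemma half_chain_midpoint G k a b N K : is_domain G -> G != [set: E] ->
  a <= b -> 1 <= N -> 0 <= K -> (forall t, t \in `[a, b] -> G (k t)) ->
  {within `[a, b], continuous k} ->
  (forall t, t \in `[a, b] ->
    `|k t - k a| <= N * bdist G (k t) \/ `|k t - k b| <= N * bdist G (k t)) ->
  (forall x y, G x -> G y -> rel_dist G x y <= 4 * N -> (qhyp G x y <= K%:E)%E) ->
  exists p l,
    [/\ [/\ G p, `|k a - p| = `|k a - k b| / 2 & `|k a - k b| / 2 <= N * bdist G p],
      path (fine_step G) (k a) l, last (k a) l = p &
    [/\ chain_length (k a) l <= expR (K + 1) ^+ 2 * bdist G p,
      forall z, z \in k a :: l -> G z &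
      left_cone_chain G (2 * expR (K + 1) ^+ 3) (k a :: l)]].
Proof.
move=> dG pG ab N1 K0 Gk ck cone short.
set D := `|k a - k b|; have D0 : 0 <= D by exact: normr_ge0.
have [|||t [at_ tb tE below]] := @first_time (fun t => `|k t - k a|) a b (D / 2) ab.
- exact: continuous_within_dist.
- by rewrite subrr normr0 divr_ge0.
- by rewrite distrC -/D; lra.
have sub s : s \in `[a, t] -> s \in `[a, b] by rewrite !in_itv /=; lra.
have tI : t \in `[a, t] by rewrite in_itv /= at_ lexx.
have conea s : s \in `[a, t] -> `|k s - k a| <= N * bdist G (k s).
  move=> sI; case: (cone s (sub s sI)) => // h; apply: le_trans h.
  have /below : a <= s by move: sI; rewrite in_itv /= => /andP[].
  have st : s <= t by move: sI; rewrite in_itv /= => /andP[].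
  move=> /(_ st); have := ler_distD (k s) (k a) (k b); rewrite -/D (distrC (k a)); lra.
have [||l [l1 l2 l3 l4 l5]] := @half_chain _ _ G k a t N K dG pG at_ N1 K0 _ _ conea short.
- by move=> s /sub; exact: Gk.
- by apply: continuous_subspaceW ck => s /sub.
exists (k t), l; split => //; split.
- exact: Gk (sub t tI).
- by rewrite distrC.
- by rewrite -tE; exact: conea.
Qed.

Definition two_sided_chain G N (s : seq E) : Prop :=
  forall s1 z s2, s = s1 ++ z :: s2 ->
    list_length (rcons s1 z) <= N * bdist G z \/ list_length (z :: s2) <= N * bdist G z.

(** The junction points occur twice; the resulting steps of length zero are fine. *)
Lemma path_cat_rev G x l p m y r : is_domain G -> G != [set: E] -> G p -> G (last p m) ->
  path (fine_step G) x l -> last x l = p -> path (fine_step G) p m ->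
  path (fine_step G) y r -> last y r = last p m ->
  path (fine_step G) x (l ++ (p :: m) ++ rev (y :: r)) /\
  last x (l ++ (p :: m) ++ rev (y :: r)) = y.
Proof.
move=> dG pG Gp Gq hl lp hm hr rq; split; last first.
  by rewrite !last_cat rev_cons last_rcons.
rewrite cat_path hl lp cat_path /= fine_step_refl ?(ltW (bdist_gt0 dG pG Gp)) //= hm /=.
rewrite lastI rev_rcons /= rq fine_step_refl ?(ltW (bdist_gt0 dG pG Gq)) //= -rq rev_path.
by rewrite (eq_path (e' := fine_step G)) // => u v; exact: fine_stepC.
Qed.
End OneSpace.

End TwoSidedChain.
Section ImageChain.
Context {R : realType}.

Lemma two_sided_cat_rev (E : normedModType R) (G : set E) (N : R) x l p m y r :
  left_cone_chain G N (x :: l) -> left_cone_chain G N (y :: r) ->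
  (forall z, z \in p :: m -> chain_length x (l ++ p :: m) <= N * bdist G z) ->
  two_sided_chain G N (x :: l ++ (p :: m) ++ rev (y :: r)).
Proof.
move=> Hl Hr Hm s1 z s2 sE.
have {sE} : (x :: l ++ p :: m) ++ rev (y :: r) = s1 ++ z :: s2.
  by rewrite -sE /= -catA.
move=> sE; have [[t e]|[t -> rE]] := cat_eq_split sE.
  by left; exact: (left_cone_cat Hl Hm) e.
right; rewrite -(list_length_rev (z :: s2)) rev_cons; apply: (Hr _ _ (rev t)).
by rewrite -[y :: r]revK rE rev_cat rev_cons cat_rcons.
Qed.

Lemma uniform_image_chain (M C c : R) (eta : R -> R) :
  1 <= M -> 0 <= C -> 1 <= c -> homeo_gauge eta -> exists2 N : R, 1 <= N &
  forall (E E' : normedModType R) (G : set E) (G' : set E') f g,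
    cqh_pair M C G G' f g -> quasimobius_rel eta (closure G) (boundary G) f ->
    uniform_domain c G -> forall x y, G' x -> G' y ->
    exists l, [/\ path (fine_step G') x l, last x l = y,
      chain_length x l <= N * `|x - y|, forall z, z \in x :: l -> G' z &
      two_sided_chain G' N (x :: l)].
Proof.
move=> M1 C0 c1 he.
have [N N1 cone] := cone_condition M1 C0 c1 he.
have N40 : 0 <= 4 * N by rewrite mulr_ge0 // (le_trans ler01).
have [K HK] := uniform_image_qhyp M1 C0 c1 he N40.
set K' := Num.max K 0; have K0 : 0 <= K' by rewrite le_max lexx orbT.
set Q := expR (K' + 1).
have Q0 : 0 < Q by exact: expR_gt0.
have Q1 : 1 <= Q by rewrite -expR0 ler_expR addr_ge0.
have Q12 : Q <= Q ^+ 2 by rewrite expr2 ler_peMl // ltW.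
have Q23 : Q ^+ 2 <= Q ^+ 3 by rewrite [leRHS]exprS ler_peMl // exprn_ge0 // ltW.
(* Three chains, of lengths at most Q^2, Q and Q^2 times a boundary distance of at most 6 D, give
   the factor 18. *)
have N'1 : 1 <= 18 * Q ^+ 3 by lra.
exists (18 * Q ^+ 3) => // E E' G G' f g fg qm uG x y Gx Gy.
have dG' := cqh_dG' fg; have pG' := cqh_pG' fg.
set D := `|x - y|; have D0 : 0 <= D := normr_ge0 _.
have dpos z : G' z -> 0 < bdist G' z by exact: bdist_gt0.
(* Deep inside the domain the single step from [x] to [y] is already fine. Otherwise both boundary
   distances are at most 5 D. *)
have [/andP[hx hy]|hxy] := boolP ((4 * D <= bdist G' x) && (4 * D <= bdist G' y)).
  have DN : D <= 18 * Q ^+ 3 * D by rewrite ler_peMl.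
  exists [:: y]; split => //=.
  - by rewrite /fine_step -/D andbT; apply/andP; split; lra.
  - by rewrite addr0.
  - by move=> z; rewrite !inE => /orP[]/eqP->.
  - move=> s1 z s2 sE; left; apply: (@le_trans _ _ D).
      have -> : D = list_length [:: x; y] by rewrite /= addr0.
      rewrite sE -cat_rcons; case: (s1) => [|w r] /=; last exact: chain_length_prefix.
      exact: chain_length_ge0.
    have zE : z = x \/ z = y.
      have : z \in [:: x; y] by rewrite sE mem_cat mem_head orbT.
      by rewrite !inE => /orP[]/eqP->; [left|right].
    have Dz : 4 * D <= bdist G' z by case: zE => ->.
    have : 1 * bdist G' z <= 18 * Q ^+ 3 * bdist G' z.
      by rewrite ler_wpM2r // (le_trans _ Dz) // mulr_ge0.
    lra.
have {}hxy : bdist G' x <= 5 * D /\ bdist G' y <= 5 * D.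
  have h1 := bdist_lip dG' pG' x y; have h2 := bdist_lip dG' pG' y x.
  rewrite (distrC y) -/D in h2; rewrite -/D in h1.
  by move: hxy; rewrite negb_and -!ltNge => /orP[]; lra.
have fgK z : G' z -> f (g z) = z by move=> ?; apply: (cqh_gK fg); exact: subset_closure.
have short u v : G' u -> G' v -> rel_dist G' u v <= 4 * N -> (qhyp G' u v <= K'%:E)%E.
  move=> Gu Gv uv; have [h [a [b [L [ha hb ug]]]]] := uniform_curve_ex uG (cqh_gG fg Gu) (cqh_gG fg Gv).
  have [[ab _ _] _ _ _ _] := ug.
  have := HK _ _ _ _ _ _ fg qm _ _ _ _ ug a b b (lexx a) ab (lexx b) (lexx b).
  rewrite ha hb !fgK // => /(_ uv) /le_trans; apply; rewrite lee_fin le_max lexx //.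
have [h [a [b [L [ha hb ug]]]]] := uniform_curve_ex uG (cqh_gG fg Gx) (cqh_gG fg Gy).
have [[ab ch Gh] _ _ _ _] := ug.
pose k := f \o h.
have ka : k a = x by rewrite /k /= ha fgK.
have kb : k b = y by rewrite /k /= hb fgK.
have ck : {within `[a, b], continuous k}.
  by apply: continuous_within_comp ch (cqh_cf fg) => t /Gh; exact: subset_closure.
have Gk t : t \in `[a, b] -> G' (k t) by move=> /Gh; exact: (cqh_fG fg).
have conek t : t \in `[a, b] ->
    `|k t - k a| <= N * bdist G' (k t) \/ `|k t - k b| <= N * bdist G' (k t).
  by rewrite in_itv /= => /andP[at_ tb]; exact: (cone _ _ _ _ _ _ fg qm _ _ _ _ ug t).
have [p [l [[Gp xp pD] l1 l2 [l3 l4 l5]]]] :=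
  half_chain_midpoint dG' pG' ab N1 K0 Gk ck conek short.
(* The path is run backwards to obtain the half that starts at [y]. *)
pose k' t := k (a + b - t).
have rI t : t \in `[a, b] -> a + b - t \in `[a, b] by rewrite !in_itv /=; lra.
have k'a : k' a = y by rewrite /k' addrAC subrr add0r.
have k'b : k' b = x by rewrite /k' addrK.
have ck' : {within `[a, b], continuous k'}.
  apply/within_continuousP => t tI e e0.
  have [r r0 Hr] := (iffLR (within_continuousP _ _) ck) _ (rI t tI) e e0.
  exists r => // s sI ts; apply: Hr; first exact: rI.
  by rewrite opprD addrACA subrr add0r opprK addrC distrC.
have [q [r [[Gq yq qD] r1 r2 [r3 r4 r5]]]] :
  exists q r,
    [/\ [/\ G' q, `|k' a - q| = `|k' a - k' b| / 2 & `|k' a - k' b| / 2 <= N * bdist G' q],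
      path (fine_step G') (k' a) r, last (k' a) r = q &
    [/\ chain_length (k' a) r <= Q ^+ 2 * bdist G' q,
      forall z, z \in k' a :: r -> G' z &
      left_cone_chain G' (2 * Q ^+ 3) (k' a :: r)]].
  apply: (half_chain_midpoint dG' pG' ab N1 K0) short => // t tI.
    exact/Gk/rI.
  rewrite k'a k'b -ka -kb; have [|] := conek _ (rI t tI); by [right|left].
rewrite k'a k'b (distrC y x) -/D in yq qD r1 r2 r3 r4 r5.
rewrite ka kb -/D in xp pD l1 l2 l3 l4 l5.
have pq : `|p - q| <= 2 * D.
  have := ler_distD x p q; have := ler_distD y x q; rewrite (distrC p x) -/D; lra.
(* |p - q| <= 2 D, and D / 2 is at most N times the boundary distance at [p] and at [q]; so their
   relative distance is at most 4 N. *)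
have [|m [m1 m2 m3 m4]] := @qhyp_chain _ _ G' dG' pG' p q K' Gp.
  by apply: short => //; rewrite rel_distP //; apply/andP; split; lra.
rewrite -/Q in m3 m4 l3 l5.
have dp : bdist G' p <= 6 * D.
  have := bdist_lip dG' pG' p x; rewrite (distrC p) xp; lra.
have dq : bdist G' q <= 6 * D.
  have := bdist_lip dG' pG' q y; rewrite (distrC q) yq; lra.
have dp0 := dpos _ Gp; have dq0 := dpos _ Gq.
have weaken s : left_cone_chain G' (2 * Q ^+ 3) s -> (forall z, z \in s -> G' z) ->
    left_cone_chain G' (18 * Q ^+ 3) s.
  move=> H Hs s1 z s2 sE; apply: le_trans (H _ _ _ sE) _.
  have Gz : G' z by apply: Hs; rewrite sE mem_cat mem_head orbT.
  by rewrite ler_pM2r ?dpos //; lra.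
have QdpD : Q ^+ 2 * bdist G' p <= Q ^+ 2 * (6 * D) by rewrite ler_pM2l // exprn_gt0.
have QdqD : Q ^+ 2 * bdist G' q <= Q ^+ 2 * (6 * D) by rewrite ler_pM2l // exprn_gt0.
have Qdp := ler_wpM2r (ltW dp0) Q12.
have Gq' : G' (last p m) by rewrite m2.
have rq : last y r = last p m by rewrite r2 m2.
have [pt1 pt2] := path_cat_rev dG' pG' Gp Gq' l1 l2 m1 r1 rq.
exists (l ++ (p :: m) ++ rev (y :: r)); split => //.
- rewrite !chain_length_cat l2 /= subrr normr0 add0r m2.
  have -> : chain_length q (rev (y :: r)) = chain_length y r.
    by rewrite -[RHS]/(list_length (y :: r)) -list_length_rev lastI rev_rcons /= r2 subrr normr0 add0r.
  have := ler_wpM2r D0 Q23; lra.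
- move=> z; rewrite -cat_cons !mem_cat mem_rev => /orP[/l4//|/orP[/m4[]//|/r4//]].
- apply: two_sided_cat_rev; [exact: weaken|exact: weaken|].
  move=> z zm; have [Gz hz] := m4 z zm.
  rewrite chain_length_cat l2 /= subrr normr0 add0r.
  have := ler_wpM2l (exprn_ge0 2 (ltW Q0)) hz; rewrite mulrA -exprSr => h1.
  have : 0 <= Q ^+ 3 * bdist G' z by rewrite mulr_ge0 ?exprn_ge0 // ltW // dpos.
  lra.
Qed.
End ImageChain.
(** * From chains to arcs *)

Section ChainToArc.
Context {R : realType} {E : normedModType R}.
Implicit Types (G : set E) (u : R -> E) (b : R) (x y z : E).

(** In a 1-Lipschitz parametrization the parameter bounds the length, and this persists when the arc
    is cut and continued. *)
Definition lipschitz_arc u b : Prop :=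
  [/\ 0 <= b, forall s t, 0 <= s -> s <= t -> t <= b -> `|u t - u s| <= t - s &
      {in `[0, b] &, injective u}].

Lemma lipschitz_arc_continuous u b : lipschitz_arc u b -> {within `[0, b], continuous u}.
Proof.
move=> [b0 lip _]; apply: (@lipschitz_within _ R E _ _ 1) => s t.
rewrite /= !in_itv /= mul1r => /andP[s0 sb] /andP[t0 tb].
have [st|/ltW ts] := leP s t; first by rewrite distrC (distrC s) (ger0_norm (_ : 0 <= t - s)) ?subr_ge0 // lip.
by rewrite (ger0_norm (_ : 0 <= s - t)) ?subr_ge0 // lip.
Qed.

(** The image of the arc is compact, so the supremum of the parameters at which the segment meets it
    is attained. *)
Lemma last_hit u b z : lipschitz_arc u b -> exists r t : R,
  [/\ 0 <= r <= 1, 0 <= t <= b, segpt (u b) z r = u t &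
    forall s, r < s -> s <= 1 -> forall t', 0 <= t' <= b -> segpt (u b) z s <> u t'].
Proof.
move=> au; have [b0 lip _] := au.
pose K := u @` `[0, b].
have cK : closed K.
  apply: compact_closed; first exact: norm_hausdorff.
  apply: continuous_compact; first exact: lipschitz_arc_continuous.
  exact: segment_compact.
pose S := [set r : R | 0 <= r <= 1 /\ K (segpt (u b) z r)].
have S0 : S 0.
  split; first by rewrite lexx ler01.
  by exists b; rewrite ?segpt0 //= in_itv /= b0 lexx.
have hub : has_ubound S by exists 1 => r [/andP[]].
have hS : has_sup S by split; [exists 0|].
have s0 : 0 <= sup S by exact: ub_le_sup.
have s1 : sup S <= 1 by apply: ge_sup; [exists 0|move=> r [/andP[]]].
have [t tI tE] : K (segpt (u b) z (sup S)).
  apply: cK; apply/closure_normP => e e0.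
  pose d := e / (`|u b - z| + 1).
  have d0 : 0 < d by rewrite divr_gt0 // ltr_wpDl.
  have [r Sr rd] := sup_adherent d0 hS.
  have rs : r <= sup S by exact: ub_le_sup.
  case: Sr => _ Kr; exists (segpt (u b) z r) => //.
  rewrite segpt_dist ger0_norm ?subr_ge0 //.
  apply: le_lt_trans (_ : (sup S - r) * (`|u b - z| + 1) < _).
    by rewrite ler_wpM2l ?subr_ge0 // lerDl.
  by rewrite -ltr_pdivlMr ?ltr_wpDl // -/d; lra.
exists (sup S), t; split => //; first by rewrite s0.
move=> s sS s_1 t' tI' h; have : s <= sup S.
  apply: ub_le_sup => //; split; first by rewrite (le_trans s0 (ltW sS)).
  by exists t'; rewrite ?h //= in_itv.
by rewrite leNgt sS.
Qed.

(* The old arc is left at the last point of the new segment that lies on it. *)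
Lemma append_segment u b z : lipschitz_arc u b ->
  exists u' b', [/\ lipschitz_arc u' b', u' 0 = u 0, u' b' = z, b' <= b + `|u b - z| &
    forall t, 0 <= t -> t <= b' ->
      [/\ u' t = u t, t <= b & b' - t <= b - t + `|u b - z|] \/
      [/\ `|u' t - u b| <= `|u b - z|, t <= b + `|u b - z| & b' - t <= `|u b - z|]].
Proof.
move=> au; have [b0 lip inj] := au; set l := `|u b - z|.
have [lz|l0] := eqVneq l 0.
  exists u, b; split => //.
  - by apply/eqP; rewrite -subr_eq0 -normr_eq0 -/l lz.
  - by rewrite lz addr0.
  - by move=> t t0 tb; left; rewrite lz addr0.
have {}l0 : 0 < l by rewrite lt0r l0 normr_ge0.
have [r [t1 [/andP[r0 r1] /andP[t10 t1b] rt1 nohit]]] := last_hit z au.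
(* After [t1] the rest of the segment is traversed at unit speed. *)
pose v t := segpt (u b) z (r + (t - t1) / l).
pose u' t := if t <= t1 then u t else v t.
pose b' := t1 + (1 - r) * l.
have t1b' : t1 <= b' by rewrite lerDl mulr_ge0 ?subr_ge0 // ltW.
have vdist s t : `|v t - v s| = `|t - s|.
  rewrite /v segpt_dist -/l opprD addrACA subrr add0r -mulrBl opprB addrA subrK.
  by rewrite normrM normfV (gtr0_norm l0) divfK // gt_eqF.
have vt1 : v t1 = u t1 by rewrite /v subrr mul0r addr0.
have lip' s t : 0 <= s -> s <= t -> t <= b' -> `|u' t - u' s| <= t - s.
  move=> s0 st tb; rewrite /u'; case: (leP t t1) => tt1; case: (leP s t1) => st1.
  - by apply: lip => //; exact: le_trans t1b.
  - lra.
  - have := ler_distD (u t1) (v t) (u s); rewrite -{1}vt1 vdist.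
    rewrite (ger0_norm (_ : 0 <= t - t1)) ?subr_ge0 ?(ltW tt1) // => h.
    have := lip s t1 s0 st1 t1b; lra.
  - by rewrite vdist ger0_norm ?subr_ge0.
have par t : t1 <= t -> t <= b' -> r <= r + (t - t1) / l <= 1.
  move=> tt tb; rewrite lerDl divr_ge0 ?subr_ge0 ?(ltW l0) //= -lerBrDl ler_pdivrMr //.
  by move: tb; rewrite /b'; lra.
have cross s t : 0 <= s -> s <= t1 -> t1 < t -> t <= b' -> u s = v t -> False.
  move=> s0 st1 tt tb h; have /andP[p1 p2] := par t (ltW tt) tb.
  apply: (nohit (r + (t - t1) / l) _ p2 s) => //; last by rewrite s0 (le_trans st1).
  by rewrite ltrDl divr_gt0 // subr_gt0.
exists u', b'; split.
- split; [exact: le_trans t1b'|exact: lip'|].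
  move=> s t; rewrite !in_itv /= => /andP[s0 sb] /andP[t0 tb]; rewrite /u'.
  case: (leP s t1) => st1; case: (leP t t1) => tt1 h.
  + by apply: inj => //; rewrite in_itv /= ?s0 ?t0 (le_trans _ t1b).
  + by case: (cross s t).
  + by case: (cross t s).
  + by apply/eqP; rewrite -subr_eq0 -normr_eq0 -vdist h subrr normr0.
- by rewrite /u' t10.
- rewrite /u'; case: leP => h.
    have r1' : r = 1.
      have : (1 - r) * l <= 0 by move: h; rewrite /b'; lra.
      by rewrite pmulr_lle0 //; lra.
    have -> : b' = t1 by rewrite /b' r1' subrr mul0r addr0.
    by rewrite -rt1 r1' segpt1.
  by rewrite /v /b' addrAC subrr add0r mulfK ?gt_eqF // addrC subrK segpt1.
- rewrite /b'; have : (1 - r) * l <= 1 * l by rewrite ler_pM2r //; lra.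
  lra.
- have rl : (1 - r) * l <= l by rewrite ler_piMl ?(ltW l0) //; lra.
  move=> t t0 tb; rewrite /u'; case: (leP t t1) => tt1; [left|right].
    by split=> //; [exact: le_trans t1b|rewrite /b'; lra].
  have /andP[p1 p2] := par t (ltW tt1) tb.
  split.
  + have := segpt_dist (u b) z (r + (t - t1) / l) 0; rewrite segpt0 subr0 -/l /v => ->.
    by rewrite ler_piMl ?(ltW l0) // ger0_norm // (le_trans r0).
  + by move: tb; rewrite /b'; lra.
  + by rewrite /b'; lra.
Qed.

(** Induction on the chain from its end. Every point of the arc is attributed to a nearby vertex;
    pruning only shortens, so the chain lengths before and after that vertex still bound the
    parameters, up to part of a step beyond the vertex. *)
Lemma chain_arc G x l : path (fine_step G) x l -> (forall z, z \in x :: l -> 0 <= bdist G z) ->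
  exists u b, [/\ lipschitz_arc u b, u 0 = x, u b = last x l, b <= chain_length x l &
    forall t, 0 <= t -> t <= b -> exists s1 z s2,
      [/\ x :: l = s1 ++ z :: s2, `|u t - z| <= bdist G z / 4,
        t <= list_length (rcons s1 z) + bdist G z / 4 & b - t <= list_length (z :: s2)]].
Proof.
elim/last_ind: l => [|l z IH].
  move=> _ pos; have d0 : 0 <= bdist G x by apply: pos; rewrite mem_head.
  exists (fun=> x), 0; split => //.
    split => //; first by move=> s t s0 st t0; rewrite subrr normr0 subr_ge0.
    by move=> s t; rewrite !in_itv /= => ? ? _; apply/eqP; rewrite eq_le; lra.
  move=> t t0 t0'; exists [::], x, [::]; split => //=.
  - by rewrite subrr normr0; lra.
  - lra.
  - lra.
rewrite rcons_path => /andP[pl fz] pos.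
have pos' w : w \in x :: l -> 0 <= bdist G w.
  by move=> wl; apply: pos; rewrite -rcons_cons mem_rcons in_cons wl orbT.
have [u [b [au u0 ub bl H]]] := IH pl pos'.
have [u' [b' [au' u0' ub' bb' H']]] := append_segment z au.
move: fz => /andP[fz _]; rewrite -ub in fz; set d := `|u b - z| in bb' H' fz.
exists u', b'; rewrite u0' u0 ub' last_rcons -cats1; split => //.
  by rewrite chain_length_cat /= addr0 -ub -/d; lra.
move=> t t0 tb'; have [[-> tb h]|[h1 h2 h3]] := H' t t0 tb'.
  have [s1 [w [s2 [sE h4 h5 h6]]]] := H t t0 tb.
  exists s1, w, (rcons s2 z); split => //.
    by rewrite -cats1 -cat_cons sE -catA.
  rewrite /= -cats1 chain_length_cat /= addr0.
  have -> : last w s2 = u b.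
    by rewrite ub -[RHS]/(last x (x :: l)) sE last_cat.
  rewrite -/d; move: h6; rewrite /=; lra.
(* Points of the new segment are attributed to its first end, the former last vertex. *)
exists (belast x l), (last x l), [:: z]; split.
- by rewrite -[RHS]cat_rcons -lastI.
- by rewrite -ub; apply: le_trans h1 _.
- by rewrite -lastI /= -ub; lra.
- by rewrite /= addr0 -ub.
Qed.

End ChainToArc.
Lemma chain_uniform (R : realType) (E : normedModType R) (G : set E) (N : R) x y l :
  is_domain G -> G != [set: E] -> 1 <= N -> path (fine_step G) x l -> last x l = y ->
  chain_length x l <= N * `|x - y| -> (forall z, z \in x :: l -> G z) ->
  two_sided_chain G N (x :: l) ->
  exists g a b, [/\ arc_in G g a b, g a = x, g b = y,
    (curve_length g a b <= (2 * N * `|x - y|)%:E)%E &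
    forall t, t \in `[a, b] ->
      (Order.min (curve_length g a t) (curve_length g t b) <= (2 * N * bdist G (g t))%:E)%E].
Proof.
move=> dG pG N1 pl ly lN Gl two.
have dl z : z \in x :: l -> 0 < bdist G z by move=> /Gl; exact: bdist_gt0.
have [|u [b [au u0 ub bl H]]] := chain_arc pl; first by move=> z /dl /ltW.
(* Within a quarter of bdist z from the vertex z one has bdist z <= 4/3 bdist (u t), and 4/3 (N +
   1/4) <= 2 N. *)
have near t : 0 <= t -> t <= b ->
    exists z, [/\ G z, `|z - u t| <= bdist G z / 4, bdist G z <= 4 / 3 * bdist G (u t) &
      t <= (N + 1 / 4) * bdist G z \/ b - t <= N * bdist G z].
  move=> t0 tb; have [s1 [z [s2 [sE h1 h2 h3]]]] := H t t0 tb.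
  have zl : z \in x :: l by rewrite sE mem_cat mem_head orbT.
  rewrite distrC in h1; exists z; split => //; first exact: Gl.
    have := bdist_lip dG pG z (u t); lra.
  by case: (two s1 z s2 sE) => h; [left|right]; lra.
have [b0 lip inj] := au.
have len s t : 0 <= s -> s <= t -> t <= b -> (curve_length u s t <= (t - s)%:E)%E.
  move=> s0 st tb; rewrite -[t - s]mul1r; apply: curve_length_lipschitz => // p q sp pq qt.
  by rewrite mul1r; apply: lip => //; [exact: le_trans sp|exact: le_trans tb].
exists u, 0, b; split => //.
- split => //; split => //; first exact: lipschitz_arc_continuous.
  move=> t; rewrite in_itv /= => /andP[t0 tb]; have [z [Gz h1 _ _]] := near t t0 tb.
  by apply: (bdist_ball dG Gz); have := bdist_gt0 dG pG Gz; lra.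
- by rewrite ub.
- apply: le_trans (len 0 b _ b0 _) _ => //; rewrite lee_fin subr0.
  have : 0 <= N * `|x - y| by rewrite mulr_ge0 // (le_trans ler01).
  lra.
- move=> t; rewrite in_itv /= => /andP[t0 tb]; have [z [Gz _ h2 h3]] := near t t0 tb.
  have N0 : 0 <= N by rewrite (le_trans ler01).
  have Nz := ler_wpM2l N0 h2; have dz := bdist_gt0 dG pG Gz.
  have Nd : bdist G z <= N * bdist G z by rewrite ler_peMl // ltW.
  rewrite ge_min; case: h3 => h3; apply/orP; [left|right].
    by apply: le_trans (len 0 t _ t0 tb) _ => //; rewrite lee_fin; lra.
  by apply: le_trans (len t b t0 tb _) _ => //; rewrite lee_fin; lra.
Qed.

Lemma uniform_image (R : realType) (M C c : R) (eta : R -> R) :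
  1 <= M -> 0 <= C -> 1 <= c -> homeo_gauge eta -> exists2 c' : R, 1 <= c' &
  forall (E E' : normedModType R) (G : set E) (G' : set E') f g,
    cqh_pair M C G G' f g -> quasimobius_rel eta (closure G) (boundary G) f ->
    uniform_domain c G -> uniform_domain c' G'.
Proof.
move=> M1 C0 c1 he; have [N N1 H] := uniform_image_chain M1 C0 c1 he.
exists (2 * N); first by lra.
move=> E E' G G' f g fg qm uG x y Gx Gy.
have [l [l1 l2 l3 l4 l5]] := H _ _ _ _ _ _ fg qm uG x y Gx Gy.
exact: (chain_uniform (cqh_dG' fg) (cqh_pG' fg) N1 l1 l2 l3 l4 l5).
Qed.

Theorem theorem1p4 (R : realType) (M C : R) (eta : R -> R)
    (hM : 1 <= M) (hC : 0 <= C) (heta : homeo_gauge eta) :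
  (forall psi : R -> R, increasing_gauge psi ->
    exists psi' : R -> R, increasing_gauge psi' /\
      forall (E E' : completeNormedModType R) (G : set E) (G' : set E')
        (f : E -> E'),
        dim_ge2 E -> dim_ge2 E' ->
        is_domain G -> G != [set: E] ->
        is_domain G' -> G' != [set: E'] ->
        coarsely_qh M C G G' f ->
        homeomorphism_on (closure G) (closure G') f ->
        quasimobius_rel eta (closure G) (boundary G) f ->
        natural_domain psi G -> natural_domain psi' G')
  /\
  (forall c : R, 1 <= c ->
    exists c' : R, 1 <= c' /\
      forall (E E' : completeNormedModType R) (G : set E) (G' : set E')
        (f : E -> E'),
        dim_ge2 E -> dim_ge2 E' ->
        is_domain G -> G != [set: E] ->
        is_domain G' -> G' != [set: E'] ->
        coarsely_qh M C G G' f ->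
        homeomorphism_on (closure G) (closure G') f ->
        quasimobius_rel eta (closure G) (boundary G) f ->
        uniform_domain c G -> uniform_domain c' G').
Proof.
split=> [psi hpsi|c c1].
- have [psi' hpsi' H] := natural_image hM hC heta hpsi.
  exists psi'; split=> // E E' G G' f d2 d2' dG pG dG' pG' qh hf qm.
  have [g fg] := cqh_pair_ex hM d2 d2' dG pG dG' pG' qh hf.
  exact: (H _ _ _ _ _ _ fg qm).
- have [c' c'1 H] := uniform_image hM hC c1 heta.
  exists c'; split=> // E E' G G' f d2 d2' dG pG dG' pG' qh hf qm.
  have [g fg] := cqh_pair_ex hM d2 d2' dG pG dG' pG' qh hf.
  exact: (H _ _ _ _ _ _ fg qm).
Qed.
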